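(* Let $k\ge 0$ and $n\ge 2k+2$ be integers. The set $\{\tilde r^{n,k}_i\}_{i=0}^{k}$ is orthogonal (in $L^2[-1,1]$) to $\mathcal{A}^{n,k}_0(\frac{\cdot+1}{2})$ and biorthogonal to the set $\{\tilde l^{n,k}_i\}_{i=0}^{k}$ (that is, $\int_{-1}^1\tilde r^{n,k}_i(t)\tilde l^{n,k}_j(t)\,dt=0$ for $i\ne j$ and $\neq 0$ for $i=j$); hence it is a basis for $\mathcal{C}^{n,k}_1(\frac{\cdot+1}{2})$. Furthermore, for $i=0,\dots,k$, $$\int_{-1}^1 \tilde r^{n,k}_i(t)\,\tilde l^{n,k}_i(t)\,dt=2^{2n+1}\frac{(n!)^2\,(-n+k+i+1)_{n-k-i-1}}{(n+k+i+3)_{n-k-i-1}\,(2n+1)!}.$$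
   Context: $(a)_0=1$, $(a)_j=a(a+1)\cdots(a+j-1)$ for $j\ge1$. For $\alpha,\beta>-1$, $p_n^{\alpha,\beta}$ is the monic Jacobi polynomial of degree $n$: $\int_{-1}^1 p_n^{\alpha,\beta}(x)x^i(1-x)^\alpha(1+x)^\beta dx=0$ for $0\le i<n$. For integers $k\ge0$, $n\ge 2k+2$ and $i=0,\dots,k$ set, on $[-1,1]$, $$\tilde r^{n,k}_i(t)=(1-t)^i(1+t)^{k+1}p^{i+k+1,\,i+k+2}_{n-k-i-1}(t),\qquad \tilde l^{n,k}_i(t)=\tilde r^{n,k}_i(-t).$$ Let $V_0^{n,k}$ be the space of functions in $L^2(\mathbf R)\cap C^k(\mathbf R)$ whose restriction to each interval $[j,j+1]$, $j\in\mathbf Z$, is a polynomial of degree at most $n$. Let $\Phi$ be a finite set of functions in $V_0^{n,k}$, each supported in $[-1,1]$, whose integer translates generate $V_0^{n,k}$ (the closed $L^2$-span of the translates is $V_0^{n,k}$) and such that the nonzero restrictions to $[0,1]$ of the elements of $\Phi$ and of their integer translates are linearly independent. Define the following spaces of functions on $[0,1]$: - $\mathcal{A}_0^{n,k}=\{g\in V_0^{n,k}: \mathrm{supp}\,g\subset[0,1]\}$, - $\mathcal{C}_0^{n,k}=\mathrm{span}\{\phi\,\chi_{[0,1]}:\phi\in\Phi\}\ominus\mathcal{A}_0^{n,k}$, - $\mathcal{C}_1^{n,k}=\mathrm{span}\{\phi(\cdot-1)\chi_{[0,1]}:\phi\in\Phi\}\ominus\mathcal{A}_0^{n,k}$, where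 $\ominus$ denotes orthogonal complement in $L^2[0,1]$. These have dimensions $n-2k-1$, $k+1$, $k+1$. For a space $X$ of functions on $[0,1]$, $X(\frac{\cdot+1}{2})$ denotes the space of functions $t\mapsto f(\frac{t+1}{2})$ on $[-1,1]$, $f\in X$. *)

(* Defs.v *)
From HB Require Import structures.
From mathcomp Require Import all_boot all_order all_algebra.
From mathcomp Require Import all_classical all_reals all_analysis.

Set Implicit Arguments.
Unset Strict Implicit.
Unset Printing Implicit Defensive.

Import Order.TTheory GRing.Theory Num.Theory.
Import numFieldNormedType.Exports.

Local Open Scope classical_set_scope.
Local Open Scope ring_scope.

(* Functions on a closed interval I are represented by functions R -> R that
   vanish outside I. *)

Section Functions.
Context {R : realType}.
Implicit Types (f g h phi : R -> R) (X A S Phi : set (R -> R)) (k n : nat).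

Definition poch (a : R) (j : nat) : R := \prod_(l < j) (a + l%:R).

Definition inner (D : set R) f g : R :=
  (\int[lebesgue_measure]_(x in D) (f x * g x))%R.

Definition is_monic_jacobi (a b : R) (n : nat) (p : {poly R}) : Prop :=
  [/\ p \is monic, size p = n.+1 &
    forall i : nat, (i < n)%N ->
      (\int[lebesgue_measure]_(x in `[(-1)%R, 1%R])
          (p.[x] * x ^+ i * (1 - x) `^ a * (1 + x) `^ b))%R = 0].

(* For a, b > -1 exactly one polynomial satisfies the predicate. *)
Definition jacobi (a b : R) (n : nat) : {poly R} :=
  xget 0 [set p | is_monic_jacobi a b n p].

Definition rtilde n k (i : nat) : R -> R := fun t =>
  (1 - t) ^+ i * (1 + t) ^+ k.+1
  * (jacobi (i + k + 1)%:R (i + k + 2)%:R (n - k - i - 1)).[t]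
  * \1_`[(-1)%R, 1%R] t.

Definition ltilde n k (i : nat) : R -> R := fun t => rtilde n k i (- t).

Definition lspan S : set (R -> R) :=
  [set f | exists m (g : 'I_m -> R -> R) (c : 'I_m -> R),
     (forall i, S (g i)) /\ f = (fun x => \sum_(i < m) c i * g i x)].

Definition free_family m (g : 'I_m -> R -> R) : Prop :=
  forall c : 'I_m -> R,
    (forall x, \sum_(i < m) c i * g i x = 0) -> forall i, c i = 0.

Definition free_set S : Prop :=
  forall m (g : 'I_m -> R -> R),
    injective g -> (forall i, S (g i)) -> free_family g.

Definition is_basis m (b : 'I_m -> R -> R) X : Prop :=
  free_family b /\ lspan (range b) = X.

Definition Ck k f : Prop :=
  (forall i, (i < k)%N -> forall x, derivable (derive1n i f) x 1) /\
  continuous (derive1n k f).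

Definition tsupp f : set R := closure [set x | f x != 0].

Definition L2 : set (R -> R) := [set f | f \in Lfun lebesgue_measure 2%:E].

Definition V0 n k : set (R -> R) :=
  [set f | [/\ L2 f, Ck k f &
    forall j : int, exists p : {poly R}, (size p <= n.+1)%N /\
      forall x, x \in `[j%:~R, j%:~R + 1] -> f x = p.[x]]].

Definition translate (j : int) f : R -> R := fun x => f (x - j%:~R).

Definition translates Phi : set (R -> R) :=
  [set translate j phi | phi in Phi & j in [set: int]].

Definition closed_span S : set (R -> R) :=
  [set f | L2 f /\ forall e : R, 0 < e -> exists2 g, lspan S g &
     (Lnorm lebesgue_measure 2%:E (fun x => (f x - g x)%:E) < e%:E)%E].

Definition ae_class X : set (R -> R) :=
  [set f | L2 f /\ exists2 g, X g & ae_eq lebesgue_measure setT f g].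

Definition restrict01 f : R -> R := f \* \1_`[0%R, 1%R].

Record is_generator n k Phi : Prop := {
  generator_finite : finite_set Phi;
  generator_V0 : Phi `<=` V0 n k;
  generator_supp : forall phi, Phi phi -> tsupp phi `<=` `[(-1)%R, 1%R];
  (* the equality of subspaces of L^2(R), whose elements are a.e.-classes *)
  generator_span : closed_span (translates Phi) = ae_class (V0 n k);
  generator_free : free_set ((restrict01 @` translates Phi) `\ cst 0) }.

(* The orthogonal complement of A in X + A, i.e. the image of X under the
   orthogonal projection along A; it is the orthogonal complement of A in X
   when A is a subspace of X.  The spaces to which it is applied below need
   not contain A: a generator may consist of a basis of A0 and of k + 1
   functions supported in [-1, 1] that straddle 0. *)
Definition ominus X A : set (R -> R) :=
  [set f | (exists2 g, X g & exists2 h, A h & f = g \+ h) /\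
           forall h, A h -> inner `[0%R, 1%R] f h = 0].

Definition A0 n k : set (R -> R) :=
  [set g | V0 n k g /\ tsupp g `<=` `[0%R, 1%R]].

Definition C1 n k Phi : set (R -> R) :=
  ominus (lspan [set restrict01 (translate 1 phi) | phi in Phi]) (A0 n k).

Definition rescale X : set (R -> R) :=
  [set (fun t => f ((t + 1) / 2)) | f in X].

End Functions.

(* Main.v *)
(* Write r_i = (1 - t)^i (1 + t)^(k+1) p with p the Jacobi polynomial, and let
   l_i(t) = r_i(-t). Up to the symmetry t -> -t, each orthogonality relation is
   the orthogonality of p to lower degrees for the weight
   (1 - t)^(i+k+1) (1 + t)^(i+k+2). With natural parameters p has an explicit
   expansion in powers of 1 - t; integrating it against (1 + t)^m reduces both
   the orthogonality of p and the value of the diagonal integral to one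
   finite-difference identity for falling factorials.

   For the basis statement, rescaled elements of C1 are the polynomials of
   degree at most n that are divisible by (1 + t)^(k+1) and orthogonal to those
   divisible by ((1 - t)(1 + t))^(k+1). Since r_i vanishes at 1 to order exactly
   i, subtracting a combination of the r_i from such a polynomial gives an
   element of A0 orthogonal to A0, so the r_i span. Conversely the r_i lie in C1
   because the functions of a generator realize all jets of order k at 0. *)

Require Import Defs.
From HB Require Import structures.
From mathcomp Require Import all_boot all_order all_algebra.
From mathcomp Require Import all_classical all_reals all_analysis.
From mathcomp Require Import measurable_realfun.
From mathcomp Require Import ring lra zify.

Set Implicit Arguments.
Unset Strict Implicit.
Unset Printing Implicit Defensive.

Import Order.TTheory GRing.Theory Num.Theory.
Import numFieldNormedType.Exports.

Local Open Scope classical_set_scope.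
Local Open Scope ring_scope.

(** * Integrals of polynomials *)

Section PolyIntegral.
Context {F : realFieldType}.
Implicit Types (p q : {poly F}) (a b c : F).

(** The coefficient at [i = 0] is a division by 0, whose value is 0. *)
Definition prim p : {poly F} := \poly_(i < (size p).+1) (p`_i.-1 / i%:R).

Lemma deriv_prim p : (prim p)^`() = p.
Proof.
apply/polyP => i; rewrite coef_deriv coef_poly ltnS /= -[RHS]mulr1.
case: ltnP => [_|/leq_sizeP ->//]; last by rewrite mul0rn mul0r.
by rewrite -[LHS]mulr_natr -mulrA mulVf // pnatr_eq0.
Qed.

Lemma deriv_eq0 p : p^`() = 0 -> p = (p`_0)%:P.
Proof.
move=> dp; apply: size1_polyC; apply/leq_sizeP => -[//|j] _.
have /eqP := congr1 (fun q : {poly F} => q`_j) dp.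
by rewrite coef_deriv coef0 mulrn_eq0 => /eqP.
Qed.

(** Integrating through a primitive keeps all evaluations algebraic, over any [realFieldType];
    [Rintegral_horner] makes the link with the Lebesgue integral. *)
Definition pint a b p := (prim p).[b] - (prim p).[a].

Lemma pint_deriv a b p : pint a b p^`() = p.[b] - p.[a].
Proof.
have /deriv_eq0 : (prim p^`() - p)^`() = 0 by rewrite derivB deriv_prim subrr.
set c := _`_0 => /eqP; rewrite subr_eq /pint => /eqP ->.
by rewrite !hornerE opprD addrACA subrr add0r.
Qed.

Fact pint_linear a b : linear_for *%R (pint a b).
Proof.
move=> c p q; rewrite -[p in LHS]deriv_prim -[q in LHS]deriv_prim.
by rewrite -derivZ -derivD pint_deriv !(hornerD, hornerZ) /pint; ring.
Qed.

HB.instance Definition _ a b :=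
  GRing.isLinear.Build F {poly F} F *%R (pint a b) (pint_linear a b).

Lemma pintZ a b c p : pint a b (c *: p) = c * pint a b p.
Proof. exact: linearZ. Qed.

Lemma pintB a b p q : pint a b (p - q) = pint a b p - pint a b q.
Proof. exact: linearB. Qed.

Lemma pint_comp_affine a b c d p : d != 0 ->
  pint a b (p \Po (d *: 'X + c%:P)) = d^-1 * pint (d * a + c) (d * b + c) p.
Proof.
move=> d0; rewrite -[p in LHS]deriv_prim.
have -> : (prim p)^`() \Po (d *: 'X + c%:P) =
          d^-1 *: (prim p \Po (d *: 'X + c%:P))^`().
  rewrite deriv_comp derivD derivZ derivX derivC addr0 -alg_polyC mulr_algr.
  by rewrite scalerA mulVf ?scale1r.
by rewrite pintZ pint_deriv !horner_comp !hornerE.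
Qed.

Lemma pint_comp_opp a p : pint (- a) a (p \Po - 'X) = pint (- a) a p.
Proof.
have -> : - 'X = (- 1) *: 'X + 0%:P :> {poly F} by rewrite scaleN1r addr0.
rewrite pint_comp_affine ?oppr_eq0 ?oner_eq0 // invrN1 !mulN1r !addr0 opprK.
by rewrite /pint opprB.
Qed.

End PolyIntegral.

(** * Lebesgue integrals of polynomials and positivity *)

Section PolyIntegralReal.
Context {R : realType}.
Implicit Types (p q : {poly R}) (a b : R) (f g : R -> R).

Lemma Rintegral_horner a b p : a < b ->
  (\int[lebesgue_measure]_(x in `[a, b]) p.[x])%R = pint a b p.
Proof.
move=> ab; rewrite /Rintegral (@continuous_FTC2 _ _ (horner (prim p))) //.
- exact/continuous_subspaceT/continuous_horner.
- split=> [x _| |]; first exact: derivable_horner.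
    exact/cvg_at_right_filter/continuous_horner.
  exact/cvg_at_left_filter/continuous_horner.
- by move=> x _; rewrite -derivE deriv_prim.
Qed.

Lemma inner_horner a b f g p q : a < b ->
  {in `[a, b], f =1 horner p} -> {in `[a, b], g =1 horner q} ->
  inner `[a, b] f g = pint a b (p * q).
Proof.
move=> ab fp gq; rewrite -Rintegral_horner //; apply: eq_Rintegral => x.
by rewrite inE /= => xab; rewrite fp // gq // hornerM.
Qed.

Lemma eq_horner_itv a b p q : a < b ->
  {in `[a, b], horner p =1 horner q} -> p = q.
Proof.
move=> ab pq; apply/eqP; rewrite -subr_eq0; apply/eqP.
(* As many distinct points of [[a, b]] as the size of [p - q], which is more than a nonzero
   polynomial of that size has roots. *)
pose s := [seq a + (b - a) / i.+1%:R | i <- iota 0 (size (p - q))].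
apply: (@roots_geq_poly_eq0 _ _ s); last by rewrite size_map size_iota.
- apply/allP => _ /mapP[i _ ->]; rewrite rootE !hornerE subr_eq0 pq //.
  rewrite in_itv /= lerDl divr_ge0 ?subr_ge0 ?(ltW ab) ?ler0n //=.
  rewrite -lerBrDl ler_pdivrMr ?ltr0n // ler_peMr ?subr_ge0 ?(ltW ab) //.
  by rewrite ler1n.
- rewrite map_inj_uniq ?iota_uniq // => i j /addrI /mulfI.
  rewrite subr_eq0 gt_eqF // => /(_ isT) /invr_inj /eqP.
  by rewrite eqr_nat => /eqP[].
Qed.

(** The primitive is nondecreasing on [[a, b]] with equal values at both ends, so it is constant. *)
Lemma pint_ge0_eq0 a b p : a < b ->
  (forall x, x \in `[a, b] -> 0 <= p.[x]) -> pint a b p = 0 -> p = 0.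
Proof.
move=> ab p0 /eqP; rewrite subr_eq0 => /eqP pab.
have mono : {in `[a, b]%R &, {homo horner (prim p) : x y / x <= y}}.
  apply: ger0_derive1_le_cc => [x _|x xab|]; first exact: derivable_horner.
    by rewrite -derivE deriv_prim p0 // (subset_itv_oo_cc xab).
  exact/continuous_subspaceT/continuous_horner.
suff : prim p = ((prim p).[a])%:P.
  by move=> /(congr1 deriv); rewrite derivC deriv_prim.
apply: (eq_horner_itv ab) => x xab; rewrite hornerC.
have := xab; rewrite in_itv /= => /andP[ax xb].
apply/eqP; rewrite eq_le -[X in _ <= X]pab !mono //.
  by rewrite in_itv /= lexx ltW.
by rewrite in_itv /= lexx ltW.
Qed.

End PolyIntegralReal.

(** * Jacobi polynomials with natural parameters *)

(** The discrete power rule, arranged to avoid truncated subtraction. *)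
Lemma ffactSnD (m e : nat) : (m.+1 ^_ e = m ^_ e + e * m ^_ e.-1)%N.
Proof.
case: e => [|e]; first by rewrite !ffactn0 mul0n addn0.
rewrite ffactSS ffactnSr /=.
by have [em|me] := leqP e m; [nia | rewrite ffact_small ?muln0].
Qed.

(* Up to sign, the [N]-th difference of [m |-> m ^_ d]. *)
Lemma sum_binom_ffact (A : pzRingType) (N d m : nat) :
  \sum_(j < N.+1) (-1) ^+ j * 'C(N, j)%:R * ((m + j) ^_ d)%:R =
  (-1) ^+ N * (d ^_ N * m ^_ (d - N))%:R :> A.
Proof.
elim: N m => [|N IHN] m.
  by rewrite big_ord1 addn0 bin0 ffactn0 subn0 mul1n !mul1r.
pose G N m (j : nat) : A := (-1) ^+ j * 'C(N, j)%:R * ((m + j) ^_ d)%:R.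
(* Pascal's rule: the sum of order [N.+1] is a difference of two sums of order [N], at [m] and
   [m.+1]. *)
have -> : \sum_(j < N.+2) G N.+1 m j =
          \sum_(j < N.+1) G N m j - \sum_(j < N.+1) G N m.+1 j.
  have -> : \sum_(j < N.+1) G N m j = \sum_(j < N.+2) G N m j.
    by rewrite [RHS]big_ord_recr /= /G bin_small // mulr0 mul0r addr0.
  rewrite 2!(big_ord_recl N.+1) /= -addrA -sumrB; congr (_ + _).
    by rewrite /G !bin0.
  apply: eq_bigr => j _; rewrite /G /bump /= !add1n binS natrD exprS addSnnS.
  by rewrite mulrDr mulrDl !mulN1r !mulNr.
rewrite !IHN -mulrBr exprSr -mulrA mulN1r ffactSnD mulnDr natrD opprD addNKr.
rewrite subnS mulnA.
(* When [d <= N] both sides vanish, one through the factor [d - N], the other through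
   [d ^_ N.+1]. *)
have [dN|Nd] := leqP d N; last by rewrite ffactnSr.
have -> : (d - N = 0)%N by apply/eqP; rewrite subn_eq0.
by rewrite muln0 mul0n [d ^_ N.+1]ffact_small.
Qed.

Section ExplicitJacobi.
Context {F : realFieldType}.
Implicit Types (p q : {poly F}) (a b c N m l : nat).

(** A beta integral, by induction on [l] and integration by parts:
    [(1 - 'X) ^+ m.+1 * (1 + 'X) ^+ l.+1] vanishes at both ends, which trades a factor [1 + 'X] for
    a factor [1 - 'X]. *)
Lemma pint_beta m l :
  pint (-1) 1 ((1 - 'X) ^+ m * (1 + 'X) ^+ l) =
  2 ^+ (m + l).+1 * m`!%:R * l`!%:R / (m + l).+1`!%:R :> F.
Proof.
have fact0 i : i`!%:R != 0 :> F by rewrite pnatr_eq0 -lt0n fact_gt0.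
have S0 i : i.+1%:R != 0 :> F by rewrite pnatr_eq0.
elim: l m => [|l IHl] m.
  have -> : (1 - 'X) ^+ m * (1 + 'X) ^+ 0 =
            (- m.+1%:R^-1 *: (1 - 'X) ^+ m.+1)^`() :> {poly F}.
    rewrite expr0 mulr1 derivZ deriv_exp /= derivB derivX derivC sub0r.
    rewrite mulN1r mulNrn scalerN scaleNr opprK -[_ ^+ m *+ _]scaler_nat scalerA.
    by rewrite mulVf ?scale1r.
  rewrite pint_deriv !hornerE subrr expr0n /= mulr0 sub0r.
  rewrite mulNr !opprK -[1 + 1]/2 factS natrM.
  by field; rewrite fact0 ?natr1 ?nat1r S0.
have D0 : pint (-1) 1 ((1 - 'X) ^+ m.+1 * (1 + 'X) ^+ l.+1)^`() = 0 :> F.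
  rewrite pint_deriv !(hornerM, horner_exp, hornerD, hornerN, hornerX, hornerC).
  by rewrite !subrr !expr0n mul0r mulr0 subrr.
have := IHl m.+1.
set B := pint _ _ _.
have DE : ((1 - 'X) ^+ m.+1 * (1 + 'X) ^+ l.+1)^`() =
   l.+1%:R *: ((1 - 'X) ^+ m.+1 * (1 + 'X) ^+ l) -
   m.+1%:R *: ((1 - 'X) ^+ m * (1 + 'X) ^+ l.+1) :> {poly F}.
  rewrite derivM !deriv_exp /= derivB derivD !derivX derivC sub0r add0r.
  rewrite mul1r mulN1r mulNrn mulNr mulrnAl mulrnAr !scaler_nat addrC.
  by [].
move: D0; rewrite DE pintB !pintZ -/B => /eqP; rewrite subr_eq0 => /eqP.
move=> E BE; apply: (mulfI (S0 m)); rewrite -E BE addSnnS !factS !natrM.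
by field; rewrite fact0 nat1r -natrD nat1r S0.
Qed.

(** The quotient of factorials is normalized so that [jac] is monic; the powers of 2 come from
    expanding in [(1 - x) / 2]. *)
Definition jac_coef a b N (j : nat) : F :=
  (-1) ^+ j * 'C(N, j)%:R * 2 ^+ (N - j) *
  ((a + N)`!%:R * (N + a + b + j)`!%:R / ((2 * N + a + b)`!%:R * (a + j)`!%:R)).

(* Up to normalization, the hypergeometric series
   2F1(-N, N + a + b + 1; a + 1; (1 - x) / 2). *)
Definition jac a b N : {poly F} :=
  \sum_(j < N.+1) jac_coef a b N j *: (1 - 'X) ^+ j.

(** Integrated term by term with [pint_beta], the sum becomes the [N]-th difference of a falling
    factorial of degree [N - m]. The hypothesis [c.+1 = b + m] covers both [c >= b] ([m > 0]), where
    the integral vanishes, and [c = b - 1] ([m = 0]), where it does not. *)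
Lemma pint_jac a b c N m : (c.+1 = b + m)%N -> (m <= N)%N ->
  pint (-1) 1 (jac a b N * (1 - 'X) ^+ a * (1 + 'X) ^+ c) =
  2 ^+ (N + a + c).+1 * (a + N)`!%:R * c`!%:R / (2 * N + a + b)`!%:R *
  ((-1) ^+ N * ((N - m) ^_ N * (N + a + b) ^_ (N - m - N))%:R).
Proof.
move=> cbm mN.
have fact0 i : i`!%:R != 0 :> F by rewrite pnatr_eq0 -lt0n fact_gt0.
rewrite -sum_binom_ffact mulr_sumr !mulr_suml linear_sum /=.
apply: eq_bigr => -[j /= jN] _.
rewrite -2!(@scalerAl _ {poly F}) pintZ -exprD pint_beta /jac_coef.
(* A factorial from [jac_coef] over one from the beta integral gives the falling factorial, because
   [c.+1 = b + m]. *)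
have <- : ((N + a + b + j) ^_ (N - m) * (j + a + c).+1`! = (N + a + b + j)`!)%N.
  rewrite -[RHS](@ffact_fact _ (N - m)); last by lia.
  by congr (_ * _`!)%N; lia.
have -> : (N + a + c).+1 = ((N - j) + (j + a + c).+1)%N by lia.
rewrite exprD natrM (addnC a j).
by field; rewrite !fact0.
Qed.

Lemma pint_jac_eq0 a b N i : (i < N)%N ->
  pint (-1) 1 (jac a b N * (1 - 'X) ^+ a * (1 + 'X) ^+ (b + i)) = 0.
Proof.
move=> iN; rewrite (@pint_jac _ _ _ _ i.+1) ?addnS //.
by rewrite [(N - _) ^_ N]ffact_small ?mul0n ?mulr0 // ltn_subrL; lia.
Qed.

(** The case [m = 0], where the [N]-th difference is a nonzero constant; it supplies the diagonal
    integrals. *)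
Lemma pint_jac_pred a c N :
  pint (-1) 1 (jac a c.+1 N * (1 - 'X) ^+ a * (1 + 'X) ^+ c) =
  2 ^+ (N + a + c).+1 * (a + N)`!%:R * c`!%:R / (2 * N + a + c.+1)`!%:R *
  ((-1) ^+ N * N`!%:R).
Proof.
by rewrite (@pint_jac _ _ _ _ 0) ?addn0 // subn0 subnn ffactnn ffactn0 muln1.
Qed.

Lemma horner_jac1 a b N : (jac a b N).[1] =
  2 ^+ N * ((a + N)`!%:R * (N + a + b)`!%:R / ((2 * N + a + b)`!%:R * a`!%:R)).
Proof.
rewrite /jac horner_sum big_ord_recl big1 => [|j _].
  by rewrite hornerZ expr0 hornerC /jac_coef bin0 subn0 !addn0 addr0 mulr1 !mul1r.
by rewrite !hornerE subrr expr0n mulr0.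
Qed.

Lemma size_one_subX_exp m : size ((1 - 'X) ^+ m : {poly F}) = m.+1.
Proof. by rewrite -opprB exprNn -signr_odd size_Msign size_exp_XsubC. Qed.

Lemma size_jac_le a b N : (size (jac a b N) <= N.+1)%N.
Proof.
apply: leq_trans (size_sum _ _ _) _; apply/bigmax_leqP => j _.
by rewrite (leq_trans (size_scale_leq _ _)) // size_one_subX_exp.
Qed.

Lemma coef_jac a b N : (jac a b N)`_N = 1.
Proof.
rewrite /jac coef_sum big_ord_recr /= big1 => [|j _]; last first.
  by rewrite coefZ nth_default ?mulr0 // size_one_subX_exp.
rewrite add0r coefZ.
have -> : ((1 - 'X) ^+ N : {poly F})`_N = (-1) ^+ N.
  have /monicP := monic_exp N (monicXsubC (1 : F)).
  rewrite lead_coefE size_exp_XsubC polyC1 /= => lc.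
  rewrite -opprB (exprNn ('X - 1)) -(signr_odd {poly F} N) mulr_sign.
  rewrite -(signr_odd F N).
  by case: odd; rewrite ?coefN lc ?expr0.
rewrite /jac_coef binn subnn expr0 !mulr1 mulrAC -exprMn mulrNN mulr1 expr1n mul1r.
have -> : (N + a + b + N = 2 * N + a + b)%N by lia.
by rewrite [X in X / _]mulrC divff // mulf_neq0 // pnatr_eq0 -lt0n fact_gt0.
Qed.

Lemma size_jac a b N : size (jac a b N) = N.+1.
Proof.
apply/eqP; rewrite eqn_leq size_jac_le ltnNge; apply/negP => /leq_sizeP.
by move=> /(_ _ (leqnn _)) /eqP; rewrite coef_jac oner_eq0.
Qed.

Lemma jac_monic a b N : jac a b N \is monic.
Proof. by rewrite monicE lead_coefE size_jac coef_jac. Qed.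

Lemma pint_jac_orth a b N q : (size q <= N)%N ->
  pint (-1) 1 (jac a b N * (1 - 'X) ^+ a * (1 + 'X) ^+ b * q) = 0.
Proof.
(* The coefficients of [r] are those of [q] in powers of [1 + 'X], which merge with the weight. *)
move=> qN; pose r := q \Po ('X - 1%:P).
have -> : q = \sum_(i < size r) r`_i *: (1 + 'X) ^+ i.
  rewrite addrC -polyC1 -comp_polyE /r -comp_polyA.
  by rewrite comp_polyB comp_polyX comp_polyC addrK comp_polyXr.
rewrite mulr_sumr linear_sum big1 // => -[i /= ir] _.
rewrite -(@scalerAr _ {poly F}) pintZ -[_ * (1 + _) ^+ i]mulrA -exprD.
rewrite pint_jac_eq0 ?mulr0 //.
by rewrite (leq_trans ir) // size_comp_poly2 // size_XsubC.
Qed.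

End ExplicitJacobi.

(** * Identification of the monic Jacobi polynomials *)

Section MonicJacobi.
Context {R : realType}.
Implicit Types (p q : {poly R}) (a b N : nat).

(** On [[-1, 1]] both bases are nonnegative, so the real powers are ordinary ones; linearity extends
    orthogonality from monomials to all test polynomials. *)
Lemma monic_jacobi_natE a b N p : is_monic_jacobi a%:R b%:R N p <->
  [/\ p \is monic, size p = N.+1 & forall q, (size q <= N)%N ->
    pint (-1) 1 (p * (1 - 'X) ^+ a * (1 + 'X) ^+ b * q) = 0].
Proof.
have intE i : (\int[lebesgue_measure]_(x in `[(-1)%R, 1%R])
    (p.[x] * x ^+ i * (1 - x) `^ a%:R * (1 + x) `^ b%:R))%R =
    pint (-1) 1 (p * (1 - 'X) ^+ a * (1 + 'X) ^+ b * 'X^i).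
  rewrite -Rintegral_horner; last by lra.
  apply: eq_Rintegral => x; rewrite inE /= in_itv /= => /andP[x1 x2].
  rewrite !powR_mulrn; [|lra|lra].
  by rewrite !(hornerM, horner_exp, hornerD, hornerN, hornerX, hornerC); ring.
split=> -[pm sp orth]; split=> //; last first.
  by move=> i iN; rewrite intE orth // size_polyXn.
move=> q qN; rewrite -[q]coefK poly_def mulr_sumr linear_sum big1 // => -[i /= iq] _.
by rewrite -(@scalerAr _ {poly R}) pintZ -intE orth ?mulr0 // (leq_trans iq).
Qed.

(** Uniqueness: the difference of two monic candidates has lower degree, hence is orthogonal to
    itself for a nonnegative weight, and so vanishes. *)
Lemma jacobi_natE a b N : jacobi a%:R b%:R N = jac a b N :> {poly R}.
Proof.
apply: xget_unique => [|p].
  apply/monic_jacobi_natE; split; [exact: jac_monic|exact: size_jac|].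
  exact: pint_jac_orth.
move=> /monic_jacobi_natE[pm sp orth].
apply/eqP; rewrite -subr_eq0; apply/eqP.
set d := _ - _.
have dN : (size d <= N)%N.
  apply/leq_sizeP => j; rewrite leq_eqVlt => /predU1P[<-|Nj].
    by rewrite coefB coef_jac -(monicP pm) lead_coefE sp subrr.
  by rewrite coefB !nth_default ?subrr ?sp ?size_jac.
have : pint (-1) 1 (d * (1 - 'X) ^+ a * (1 + 'X) ^+ b * d) = 0.
  by rewrite !mulrBl pintB orth // pint_jac_orth // subrr.
move=> /pint_ge0_eq0 -/(_ _ _)/eqP.
rewrite !mulf_eq0 !expf_eq0.
have -> : (1 - 'X == 0 :> {poly R}) = false.
  by rewrite -size_poly_eq0 -[_ - _]expr1 size_one_subX_exp.
have -> : (1 + 'X == 0 :> {poly R}) = false.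
  by rewrite -size_poly_eq0 addrC -polyC1 size_XaddC.
rewrite !andbF !orbF orbb => H; apply/eqP/H; first by lra.
move=> x; rewrite in_itv /= => /andP[x1 x2].
rewrite !(hornerM, horner_exp, hornerD, hornerN, hornerX, hornerC).
rewrite mulrC !mulrA -expr2.
do 2![apply: mulr_ge0; last by rewrite exprn_ge0 //; lra].
exact: sqr_ge0.
Qed.

End MonicJacobi.

(** * The polynomials r_i and l_i *)

Section RPoly.
Context {F : realFieldType}.
Variables (n k : nat).
Hypothesis hn : (2 * k + 2 <= n)%N.
Implicit Types (p q s : {poly F}) (i j : nat).

Definition rpoly i : {poly F} :=
  (1 - 'X) ^+ i * (1 + 'X) ^+ k.+1 * jac (i + k + 1) (i + k + 2) (n - k - i - 1).

Definition lpoly i : {poly F} := rpoly i \Po - 'X.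

Lemma size_one_addX_exp m : size ((1 + 'X) ^+ m : {poly F}) = m.+1.
Proof.
by rewrite addrC -[1]opprK -polyC1 -polyCN size_exp_XsubC.
Qed.

Lemma size_mul_le_add (p q : {poly F}) (d e : nat) :
  (size p <= d.+1)%N -> (size q <= e)%N -> (size (p * q)%R <= d + e)%N.
Proof.
move=> pd qe; apply: leq_trans (size_polyMleq _ _) _; lia.
Qed.

Lemma size_rpoly i : (i <= k)%N -> (size (rpoly i) <= n.+1)%N.
Proof.
move=> ik; have -> : n.+1 = ((i + k.+1) + (n - k - i - 1).+1)%N by lia.
apply: size_mul_le_add; last exact: size_jac_le.
rewrite -addnS; apply: size_mul_le_add; first by rewrite size_one_subX_exp.
by rewrite size_one_addX_exp.
Qed.

Lemma lpolyE i : lpoly i =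
  (1 + 'X) ^+ i * (1 - 'X) ^+ k.+1 *
  (jac (i + k + 1) (i + k + 2) (n - k - i - 1) \Po - 'X).
Proof.
rewrite /lpoly /rpoly !comp_polyM !rmorphXn /= comp_polyB comp_polyD.
by rewrite comp_polyX comp_polyC opprK.
Qed.

(** The powers of [1 - 'X] gather to exactly the weight of the first Jacobi polynomial; only the
    power of [1 + 'X] remains to be compared. *)
Lemma rpoly_lpolyE i j : pint (-1) 1 (rpoly i * lpoly j) =
  pint (-1) 1 (jac (i + k + 1) (i + k + 2) (n - k - i - 1) *
    (1 - 'X) ^+ (i + k + 1) * (1 + 'X) ^+ (j + k + 1) *
    (jac (j + k + 1) (j + k + 2) (n - k - j - 1) \Po - 'X)).
Proof.
rewrite lpolyE /rpoly; congr pint.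
by rewrite !addn1 -2!addnS !exprD; ring.
Qed.

(** The power [2k + 2] of [1 + 'X] exceeds the weight exponent [i + k + 2] by [k - i]; the surplus
    times [s] still has degree below that of the Jacobi polynomial. *)
Lemma rpoly_orth i s : (i <= k)%N -> (size s <= n - k.*2.+1)%N ->
  pint (-1) 1 (rpoly i * ((1 - 'X) ^+ k.+1 * (1 + 'X) ^+ k.+1 * s)) = 0.
Proof.
move=> ik ss.
rewrite -(@pint_jac_orth F (i + k + 1) (i + k + 2) (n - k - i - 1)
  ((1 + 'X) ^+ (k - i) * s)); last first.
  have -> : (n - k - i - 1 = (k - i) + (n - k.*2.+1))%N by lia.
  by apply: size_mul_le_add; rewrite ?size_one_addX_exp.
congr pint; rewrite /rpoly.
have E : (1 + 'X) ^+ (i + k + 2) * (1 + 'X) ^+ (k - i) =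
         (1 + 'X) ^+ k.+1 * (1 + 'X) ^+ k.+1 :> {poly F}.
  by rewrite -!exprD; congr (_ ^+ _); lia.
rewrite [RHS]mulrA -[X in X * s]mulrA E addn1 -addnS exprD; ring.
Qed.

(** For [i < j] the exponent [j + k + 1] reaches [i + k + 2], and the surplus times the second
    Jacobi polynomial has degree at most [n - k - i - 2]. *)
Lemma rpoly_lpoly_lt i j : (i < j <= k)%N ->
  pint (-1) 1 (rpoly i * lpoly j) = 0.
Proof.
move=> /andP[ij jk]; rewrite rpoly_lpolyE.
have -> : (j + k + 1 = (i + k + 2) + (j - i.+1))%N by lia.
rewrite (exprD _ (i + k + 2)) mulrA -(mulrA (jac _ _ _ * _ * _)) pint_jac_orth //.
have -> : (n - k - i - 1 = (j - i.+1) + (n - k - j - 1).+1)%N by lia.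
apply: size_mul_le_add; first by rewrite size_one_addX_exp.
by rewrite size_comp_poly2 ?size_polyN ?size_polyX // size_jac_le.
Qed.

(** The reflection of the interval exchanges the roles of [i] and [j], which reduces the case
    [j < i] to [i < j]. *)
Lemma rpoly_lpoly_sym i j :
  pint (-1) 1 (rpoly i * lpoly j) = pint (-1) 1 (rpoly j * lpoly i).
Proof.
rewrite -[LHS]pint_comp_opp comp_polyM -comp_polyA raddfN /= comp_polyX.
by rewrite opprK comp_polyXr mulrC.
Qed.

Lemma rpoly_lpoly_neq i j : (i <= k)%N -> (j <= k)%N -> i != j ->
  pint (-1) 1 (rpoly i * lpoly j) = 0.
Proof.
move=> ik jk; rewrite neq_ltn => /orP[ij|ji]; first by rewrite rpoly_lpoly_lt ?ij.
by rewrite rpoly_lpoly_sym rpoly_lpoly_lt ?ji.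
Qed.

(* [jac a a.+1 N \Po - 'X] is its value at [-1] plus [1 + 'X] times a
   polynomial of degree less than [N], which is orthogonal to [jac a a.+1 N]
   for the weight [(1 - 'X) ^+ a * (1 + 'X) ^+ a.+1]. *)
Lemma rpoly_lpoly_diag i : (i <= k)%N ->
  let a := (i + k + 1)%N in
  pint (-1) 1 (rpoly i * lpoly i) =
  2 ^+ (2 * n + 1) * (n`!%:R ^+ 2 * ((-1) ^+ (n - a) * (n - a)`!%:R)) *
  (n + a).+1`!%:R / (2 * n + 1)`!%:R ^+ 2.
Proof.
move=> ik a; rewrite rpoly_lpolyE -/a.
have -> : (i + k + 2 = a.+1)%N by rewrite /a; lia.
have -> : (n - k - i - 1 = n - a)%N by rewrite /a; lia.
have an : (a <= n)%N by rewrite /a; lia.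
set N := (n - a)%N; set J := jac a a.+1 N.
have [s sE] : exists s, J \Po - 'X = J.[1]%:P + (1 + 'X) * s.
  have /factor_theorem[s E] : root (J \Po - 'X - J.[1]%:P) (- 1).
    by rewrite rootE !hornerE horner_comp !hornerE opprK subrr.
  exists s; have -> : 1 + 'X = 'X - (-1)%:P :> {poly F}.
    by rewrite polyCN opprK addrC.
  rewrite [_ * s]mulrC -E.
  by rewrite addrC subrK.
have ss : (size s <= N)%N.
  have [->|s0] := eqVneq s 0; first by rewrite size_poly0.
  have : (size ((1 + 'X) * s)%R <= N.+1)%N.
    have -> : (1 + 'X) * s = J \Po - 'X - J.[1]%:P by rewrite sE [RHS]addrC addKr.
    rewrite (leq_trans (size_polyD _ _)) // geq_max size_polyN.
    rewrite size_comp_poly2 ?size_polyN ?size_polyX // size_jac leqnn.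
    by rewrite (leq_trans (size_polyC_leq1 _)).
  rewrite size_mul // -?size_poly_eq0 -[1 + 'X]expr1 size_one_addX_exp //.
rewrite sE mulrDr [_ * J.[1]%:P]mulrC mul_polyC linearD /= pintZ.
rewrite mulrA -[_ * (1 + 'X)]mulrA -exprSr pint_jac_orth // addr0.
rewrite pint_jac_pred horner_jac1.
have fact0 l : l`!%:R != 0 :> F by rewrite pnatr_eq0 -lt0n fact_gt0.
have -> : (a + N = n)%N by rewrite /N; lia.
have -> : (2 * N + a + a.+1 = 2 * n + 1)%N by rewrite /N; lia.
have -> : (N + a + a.+1 = (n + a).+1)%N by rewrite /N; lia.
have -> : (2 * n + 1 = N + (N + a + a).+1)%N by rewrite /N; lia.
rewrite exprD; field; by rewrite !fact0.
Qed.

Lemma rpoly_lpoly_diag_neq0 i : (i <= k)%N ->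
  pint (-1) 1 (rpoly i * lpoly i) != 0.
Proof.
move=> ik; rewrite rpoly_lpoly_diag //=.
have fact0 l : l`!%:R != 0 :> F by rewrite pnatr_eq0 -lt0n fact_gt0.
by rewrite !mulf_neq0 ?invr_neq0 ?expf_neq0 ?fact0 ?oppr_eq0 ?oner_neq0 ?pnatr_eq0.
Qed.

(* [rpoly i] vanishes at 1 to order exactly [i]. *)
Lemma rpoly_interp m q : (m <= k.+1)%N ->
  exists c : nat -> F, (1 - 'X) ^+ m %| q - \sum_(i < m) c i *: rpoly i.
Proof.
elim: m => [|m IHm] mk; first by exists (fun=> 0); rewrite expr0 dvd1p.
have [c /dvdpP[s sE]] := IHm (ltnW mk).
(* The cofactor of [(1 - 'X) ^+ m] in [rpoly m]. As [u.[1]] is nonzero, the coefficient [s.[1] /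
   u.[1]] makes the remainder vanish to one more order at 1. *)
pose u := (1 + 'X) ^+ k.+1 * jac (m + k + 1) (m + k + 2) (n - k - m - 1) : {poly F}.
have u1 : u.[1] != 0.
  rewrite hornerM horner_exp !hornerE horner_jac1.
  by rewrite !mulf_neq0 ?invr_neq0 ?mulf_neq0 ?expf_neq0 ?pnatr_eq0 -?lt0n ?fact_gt0.
exists (fun i => if i == m then s.[1] / u.[1] else c i).
rewrite big_ord_recr /= eqxx.
rewrite (eq_bigr (fun i : 'I_m => c i *: rpoly i)); last first.
  by move=> i _; rewrite ltn_eqF.
rewrite opprD addrA sE.
have -> : rpoly m = u * (1 - 'X) ^+ m by rewrite /rpoly /u; ring.
rewrite scalerAl -mulrBl exprS dvdp_mul2r -?size_poly_eq0 ?size_one_subX_exp //.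
rewrite -opprB -polyC1 dvdpNl dvdp_XsubCl rootE hornerD hornerN hornerZ.
by rewrite divfK ?subrr.
Qed.

End RPoly.

(** * Smooth piecewise polynomials *)

Section RootOrder.
Context {F : realFieldType}.
Implicit Types (p s : {poly F}) (c : F) (i m : nat).

Lemma dvdp_deriv m c p : ('X - c%:P) ^+ m.+1 %| p -> ('X - c%:P) ^+ m %| p^`().
Proof.
move=> /dvdpP[s ->]; rewrite derivM deriv_exp derivXsubC mul1r /=.
by rewrite dvdp_add ?dvdp_mull ?dvdp_exp2l // -mulr_natl dvdp_mull.
Qed.

Lemma dvdp_derivn_eq0 m c p i : ('X - c%:P) ^+ m %| p -> (i < m)%N ->
  p^`(i).[c] = 0.
Proof.
elim: i m p => [|i IHi] [//|m] p pc im.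
  by apply/rootP; rewrite -dvdp_XsubCl (dvdp_trans _ pc) // dvdp_exp.
by rewrite derivSn (IHi m) // dvdp_deriv.
Qed.

Lemma derivn_exp_mul m c s : (('X - c%:P) ^+ m * s)^`(m).[c] = m`!%:R * s.[c].
Proof.
elim: m s => [|m IHm] s; first by rewrite derivn0 expr0 !mul1r.
have E : (('X - c%:P) ^+ m.+1 * s)^`() =
         ('X - c%:P) ^+ m * (s *+ m.+1 + ('X - c%:P) * s^`()).
  by rewrite derivM deriv_exp derivXsubC /= exprSr; ring.
rewrite derivSn E IHm hornerD hornerMn hornerM hornerXsubC subrr mul0r addr0.
by rewrite -[s.[c] *+ _]mulr_natl factS natrM; ring.
Qed.

(** Once [p] is [('X - c%:P) ^+ m * s], its [m]-th derivative at [c] is a nonzero multiple of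
    [s.[c]], so its vanishing yields one more factor. *)
Lemma derivn_eq0_dvdp m c p : (forall i, (i < m)%N -> p^`(i).[c] = 0) ->
  ('X - c%:P) ^+ m %| p.
Proof.
elim: m => [|m IHm] pc; first by rewrite expr0 dvd1p.
have /dvdpP[s sE] := IHm (fun i im => pc i (ltnW im)).
have /eqP := pc m (leqnn _); rewrite sE mulrC derivn_exp_mul mulf_eq0.
rewrite pnatr_eq0 -leqn0 leqNgt fact_gt0 /= => s0.
by rewrite exprSr dvdp_mul // dvdp_XsubCl.
Qed.

Lemma derivn_comp_addX i c p : (p \Po ('X + c%:P))^`(i) = p^`(i) \Po ('X + c%:P).
Proof.
elim: i => [//|i IHi].
by rewrite !derivnS IHi deriv_comp derivD derivX derivC addr0 mulr1.
Qed.

End RootOrder.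

(** * Smooth functions with polynomial pieces *)

Section SmoothPieces.
Context {R : realType}.
Implicit Types (p q s : {poly R}) (a b c x : R) (f g : R -> R) (k i : nat).

(** Peels off the innermost derivative, so that inductions on [k] can pass from [f] to
    [derive1 f]. *)
Lemma CkS k f : Ck k.+1 f <-> (forall x, derivable f x 1) /\ Ck k (derive1 f).
Proof.
have iterE i : derive1n i (derive1 f) = derive1n i.+1 f.
  by rewrite /derive1n iterSr.
split=> [[df cf]|[df [ddf cf]]].
  split=> [x|]; first exact: (df 0).
  by split=> [i ik x|]; rewrite iterE //; apply: df.
by split=> [[|i] ik x|]; [exact: df|rewrite -iterE; exact: ddf|rewrite -iterE].
Qed.

Lemma Ck_continuous k f : Ck k f -> continuous f.
Proof.
case: k => [[]//|k /CkS[df _] x].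
exact/differentiable_continuous/derivable1_diffP.
Qed.

Lemma CkB k f g : Ck k f -> Ck k g -> Ck k (f \- g).
Proof.
elim: k f g => [|k IHk] f g.
  by move=> [_ cf] [_ cg]; split=> // x; apply: cvgB; [exact: cf|exact: cg].
move=> /CkS[df Cf] /CkS[dg Cg]; apply/CkS; split=> [x|].
  exact: derivableB.
have -> : derive1 (f \- g) = derive1 f \- derive1 g; last exact: IHk.
by apply/funext => x /=; rewrite !derive1E deriveB.
Qed.

(** Building block of the splines below: differences of such functions switch polynomials at the
    knots. *)
Definition trunc c p : R -> R := fun x => if c <= x then p.[x] else 0.

Lemma continuous_trunc c p : root p c -> continuous (trunc c p).
Proof.
(* Since [p] vanishes at [c], truncating [p] amounts to clamping its argument from below at [c]. *)
move=> /rootP pc; have -> : trunc c p = horner p \o (id \max cst c).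
  by apply/funext => x /=; rewrite /trunc; case: leP.
move=> x; apply: continuous_comp; last exact: continuous_horner.
by apply: continuous_max; [exact: cvg_id|exact: cvg_cst].
Qed.

Lemma is_derive_trunc c p x : ('X - c%:P) ^+ 2 %| p ->
  is_derive x 1 (trunc c p) (trunc c p^`() x).
Proof.
move=> pc; have [xc|cx|xc] := ltgtP x c.
- rewrite {2}/trunc leNgt xc /=.
  apply: (@near_eq_is_derive _ _ _ (cst 0)).
  near=> y; rewrite /trunc leNgt ifF //; apply/negbF.
  by near: y; apply: lt_nbhsl.
- rewrite {2}/trunc ltW //.
  apply: (@near_eq_is_derive _ _ _ (horner p)).
  near=> y; rewrite /trunc ifT // ltW //.
  by near: y; apply: lt_nbhsr.
- have /dvdpP[s sE] := pc; apply/is_derive1_caratheodory.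
  (* The difference quotient at [c], which is continuous because it vanishes at [c]. *)
  exists (trunc c (('X - c%:P) * s)); split.
  + move=> z; rewrite xc /trunc lexx.
    by case: ifP => _; rewrite sE !(hornerM, horner_exp, hornerXsubC); ring.
  + by apply: continuous_trunc; rewrite rootE !hornerE subrr mul0r.
  + rewrite /trunc xc lexx (dvdp_derivn_eq0 (i := 1) pc) //.
    by rewrite !hornerE subrr mul0r.
Unshelve. all: by end_near. Qed.

Lemma Ck_trunc k c p : ('X - c%:P) ^+ k.+1 %| p -> Ck k (trunc c p).
Proof.
elim: k p => [|k IHk] p pc.
  by split=> //; apply: continuous_trunc; rewrite -dvdp_XsubCl.
have d x : is_derive x 1 (trunc c p) (trunc c p^`() x).
  by apply: is_derive_trunc; rewrite (dvdp_trans _ pc) // dvdp_exp2l.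
apply/CkS; split=> [x|]; first exact: ex_derive.
have -> : derive1 (trunc c p) = trunc c p^`().
  by apply/funext => x; rewrite derive1E derive_val.
exact/IHk/dvdp_deriv.
Qed.

Lemma continuous_eq_itv f g a b : a < b -> continuous f -> continuous g ->
  {in `]a, b[, f =1 g} -> {in `[a, b], f =1 g}.
Proof.
move=> ab cf cg fg x; rewrite in_itv /= => /andP[].
rewrite le_eqVlt => /predU1P[<- _|ax].
  apply: (@cvg_unique _ (@Rhausdorff R) (f @ a^'+)).
    exact/cvg_at_right_filter/cf.
  apply: cvg_trans (cvg_at_right_filter (cg a)); apply: near_eq_cvg.
  near=> y; apply/esym/fg; rewrite in_itv /=; apply/andP; split.
    by near: y; exact: nbhs_right_gt.
  by near: y; exact: nbhs_right_lt.
rewrite le_eqVlt => /predU1P[->|xb]; last by apply: fg; rewrite in_itv /= ax.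
apply: (@cvg_unique _ (@Rhausdorff R) (f @ b^'-)).
  exact/cvg_at_left_filter/cf.
apply: cvg_trans (cvg_at_left_filter (cg b)); apply: near_eq_cvg.
near=> y; apply/esym/fg; rewrite in_itv /=; apply/andP; split.
  by near: y; exact: nbhs_left_gt.
by near: y; exact: nbhs_left_lt.
Unshelve. all: by end_near. Qed.

(** Inside the interval derivatives are local; continuity of the derivatives of [f] carries the
    equality to the endpoints, where [f] may follow another polynomial on the other side. *)
Lemma Ck_horner k f p a b i : a < b -> Ck k f -> {in `[a, b], f =1 horner p} ->
  (i <= k)%N -> {in `[a, b], derive1n i f =1 horner p^`(i)}.
Proof.
move=> ab; elim: i k f p => [//|i IHi] [//|k] f p /CkS[df Cf] fp ik x xab.
have -> : derive1n i.+1 f = derive1n i (derive1 f) by rewrite /derive1n iterSr.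
rewrite derivSn; apply: (IHi k (derive1 f) p^`() Cf _ ik x xab) => {x xab}.
apply: (continuous_eq_itv ab (Ck_continuous Cf) (@continuous_horner _ _)).
move=> x xab; rewrite derivE !derive1E; apply: near_eq_derive.
have := near_in_itvoo xab; apply: filterS => y yab.
exact/fp/subset_itv_oo_cc.
Qed.

End SmoothPieces.

Lemma eqp_one_subX_exp {F : fieldType} m :
  ((1 - 'X) ^+ m : {poly F}) %= ('X - 1%:P) ^+ m.
Proof.
by rewrite eqp_exp // -opprB polyC1 -scaleN1r eqp_scale // oppr_eq0 oner_eq0.
Qed.

(** * Splines with integer knots and the space [A0] *)

Section Splines.
Context {R : realType}.
Implicit Types (p q s : {poly R}) (a b c x : R) (f g : R -> R) (n k i : nat).

Lemma tsupp_subset_itv f a b :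
  tsupp f `<=` `[a, b] <-> forall x, x \notin `[a, b] -> f x = 0.
Proof.
split=> [sf x|f0].
  apply: contraNeq => fx0; apply/(sf x)/subset_closure.
  exact: fx0.
have /closure_id -> : closed (`[a, b] : set R) by exact: interval_closed.
by apply: closureS => x /=; apply: contraNT => /f0 ->.
Qed.

(** Both pieces compute the same derivatives of [f] at [c] up to order [k]. *)
Lemma Ck_match k f p q a c b : a < c -> c < b -> Ck k f ->
  {in `[a, c], f =1 horner p} -> {in `[c, b], f =1 horner q} ->
  ('X - c%:P) ^+ k.+1 %| q - p.
Proof.
move=> ac cb Cf fp fq; apply: derivn_eq0_dvdp => i; rewrite ltnS => ik.
rewrite derivnB hornerD hornerN.
rewrite -(Ck_horner ac Cf fp ik) ?in_itv /= ?lexx ?ltW //.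
by rewrite -(Ck_horner cb Cf fq ik) ?in_itv /= ?lexx ?ltW // subrr.
Qed.

(** Continuity is asked of [g] only, so that polynomials cut off by an indicator, which may jump at
    the ends, are covered. *)
Lemma L2_itv f g a b : measurable_fun setT f -> continuous g ->
  {in `[a, b], f =1 g} -> (forall x, x \notin `[a, b] -> f x = 0) -> L2 f.
Proof.
move=> mf cg fg f0; rewrite /L2 /= inE; apply/andP; split; first by rewrite inE.
rewrite inE /= /finite_norm unlock poweR_lty //.
have <- : (\int[lebesgue_measure]_(x in `[a, b]) (g x ^+ 2)%:E =
           \int[lebesgue_measure]_x `|(f x)%:E| `^ 2)%E.
  rewrite [LHS]integral_mkcond; apply: eq_integral => x _; rewrite patchE.
  case: ifPn => [|].
    rewrite inE => /fg <-.
    by rewrite poweR_EFin /= powR_mulrn // real_normK ?num_real.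
  rewrite notin_setE /= => /negP /f0 ->.
  by rewrite /= normr0 powR0 ?pnatr_eq0.
have ci : lebesgue_measure.-integrable `[a, b] (EFin \o (fun x => g x ^+ 2)).
  apply: continuous_compact_integrable; first exact: segment_compact.
  by apply: continuous_subspaceT => x; apply: cvgM; exact: cg.
have [_] := integrableP _ _ _ ci.
by under eq_integral do rewrite /= ger0_norm ?sqr_ge0 //.
Qed.

Lemma L2_continuous f a b : continuous f ->
  (forall x, x \notin `[a, b] -> f x = 0) -> L2 f.
Proof.
move=> cf f0; apply: (@L2_itv f f a b) => //.
exact: continuous_measurable_fun.
Qed.

Definition pieces n f := forall j : int, exists p, (size p <= n.+1)%N /\
  forall x, x \in `[j%:~R, j%:~R + 1] -> f x = p.[x].

Lemma piecesB n f g : pieces n f -> pieces n g -> pieces n (f \- g).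
Proof.
move=> pf pg j; have [p [sp fp]] := pf j; have [q [sq gq]] := pg j.
exists (p - q); split=> [|x xj]; last by rewrite /= fp ?gq ?hornerD ?hornerN.
by rewrite (leq_trans (size_polyD _ _)) // geq_max size_polyN sp.
Qed.

Lemma pieces_trunc n (c : int) p : (size p <= n.+1)%N -> root p c%:~R ->
  pieces n (trunc c%:~R p).
Proof.
move=> sp /rootP pc j; have [cj|jc] := lerP c j.
  exists p; split=> // x; rewrite in_itv /= => /andP[jx _].
  by rewrite /trunc ifT // (le_trans _ jx) // ler_int.
exists 0; rewrite size_poly0; split=> // x; rewrite in_itv /= => /andP[_].
rewrite -[1]/(1%:~R) -intrD => xj; rewrite /trunc horner0.
(* As [j < c], the only point left is [x = c = j + 1], where [p] vanishes. *)
case: leP => // cx; rewrite -[RHS]pc; congr (_.[_]); apply/eqP.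
by rewrite eq_le cx (le_trans xj) // ler_int lezD1.
Qed.

Lemma V0_intro n k f a b : Ck k f -> pieces n f ->
  (forall x, x \notin `[a, b] -> f x = 0) -> V0 n k f.
Proof.
move=> Cf pf f0; split=> //.
by apply: (L2_continuous (a := a) (b := b)) => //; exact: Ck_continuous Cf.
Qed.

(** [g] vanishes on the neighbouring intervals, so matching at the knots 0 and 1 forces the two
    coprime factors. *)
Lemma A0_horner n k g : A0 n k g -> exists s,
  [/\ (size ((1 - 'X) ^+ k.+1 * 'X ^+ k.+1 * s)%R <= n.+1)%N,
     (forall x, x \notin `[0, 1] -> g x = 0) &
     {in `[0, 1], g =1 horner ((1 - 'X) ^+ k.+1 * 'X ^+ k.+1 * s)}].
Proof.
move=> [[_ Cg pg] /tsupp_subset_itv g0].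
have [p [sp]] := pg 0; rewrite add0r => gp.
have cg := Ck_continuous Cg.
have gout a b : a < b -> (forall x, x \in `]a, b[ -> x \notin `[0%R, 1%R]) ->
    {in `[a, b], g =1 horner 0}.
  move=> ab ab01; apply: continuous_eq_itv => //; first exact: continuous_horner.
  by move=> x /ab01 /g0 ->; rewrite horner0.
have p0 : 'X ^+ k.+1 %| p.
  have := @Ck_match k g 0 p (-1) 0 1 _ _ Cg _ gp.
  rewrite !subr0; apply; [lra|lra|apply: gout; first by lra].
  by move=> x; rewrite !in_itv /=; lra.
have p1 : (1 - 'X) ^+ k.+1 %| p.
  have := @Ck_match k g p 0 0 1 2 _ _ Cg gp.
  rewrite sub0r dvdpNr (eqp_dvdl _ (eqp_one_subX_exp _)).
  apply; [lra|lra|apply: gout; first by lra].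
  by move=> x; rewrite !in_itv /=; lra.
have /dvdpP[s sE] : (1 - 'X) ^+ k.+1 * 'X ^+ k.+1 %| p.
  rewrite Gauss_dvdp ?p0 ?p1 //.
  rewrite (eqp_coprimepl _ (eqp_one_subX_exp _)) coprimep_expl //.
  by rewrite coprimep_expr // coprimep_sym coprimep_XsubC rootX oner_eq0.
by exists s; rewrite mulrC -sE; split.
Qed.

Lemma A0_intro n k s g :
  (size ((1 - 'X) ^+ k.+1 * 'X ^+ k.+1 * s)%R <= n.+1)%N ->
  (forall x, x \notin `[0, 1] -> g x = 0) ->
  {in `[0, 1], g =1 horner ((1 - 'X) ^+ k.+1 * 'X ^+ k.+1 * s)} -> A0 n k g.
Proof.
set p := _ * s => sp g0 gp.
have p0 : ('X - 0%:P) ^+ k.+1 %| p by rewrite subr0 /p dvdp_mulr // dvdp_mull.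
have p1 : ('X - 1%:P) ^+ k.+1 %| p.
  by rewrite -(eqp_dvdl _ (eqp_one_subX_exp _)) /p !dvdp_mulr.
have r0 : root p 0%:~R by rewrite -dvdp_XsubCl (dvdp_trans _ p0) // dvdp_exp.
have r1 : root p 1%:~R by rewrite -dvdp_XsubCl (dvdp_trans _ p1) // dvdp_exp.
(* [p] is switched on at 0 and off at 1; at 1 itself both sides are 0 because [p] vanishes there. *)
have gE : g = trunc 0%:~R p \- trunc 1%:~R p.
  apply/funext => x /=; rewrite /trunc.
  have [x01|x01] := boolP (x \in `[0, 1]).
    rewrite gp //; move: x01; rewrite in_itv /= => /andP[-> x1].
    case: leP => [x1'|_]; last by rewrite subr0.
    have -> : x = 1%:~R by apply/eqP; rewrite eq_le x1.
    by rewrite subrr; apply/rootP.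
  rewrite g0 //; move: x01; rewrite in_itv /= negb_and -!ltNge => /orP[x0|x1].
    rewrite leNgt x0 leNgt (lt_trans x0) ?subrr //.
  by rewrite (ltW x1) ifT ?subrr // (le_trans _ (ltW x1)).
split; last exact/tsupp_subset_itv.
apply: (V0_intro (a := 0) (b := 1)) => //; rewrite gE.
  by apply: CkB; apply: Ck_trunc.
by apply: piecesB; apply: pieces_trunc.
Qed.

End Splines.

(** * Jets of a generator *)

Section Jets.
Context {R : realType}.
Implicit Types (p q s : {poly R}) (a b c x : R) (f g h : R -> R).

(** Riesz representation in finite dimension: the Gram matrix [G] of the monomials is invertible
    because the integral of a square vanishes only for the zero polynomial. *)
Lemma pint_riesz a b d (L : {linear {poly R} -> R | *%R}) : a < b ->
  exists q, forall p, (size p <= d)%N -> pint a b (p * q) = L p.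
Proof.
move=> ab; pose P (v : 'rV[R]_d) : {poly R} := \poly_(i < d) oapp (v 0) 0 (insub i).
have PE v : P v = \sum_(i < d) v 0 i *: 'X^i.
  rewrite /P poly_def; apply: eq_bigr => i _; by rewrite valK.
pose G : 'M[R]_d := \matrix_(i, j) pint a b ('X^i * 'X^j).
have GE v w : pint a b (P v * P w) = (v *m G *m w^T) 0 0.
  rewrite !PE mulr_suml linear_sum mxE /=.
  under [RHS]eq_bigr do rewrite mxE mulr_suml.
  rewrite exchange_big /=; apply: eq_bigr => i _.
  rewrite mulr_sumr linear_sum; apply: eq_bigr => j _ /=.
  rewrite -(@scalerAl _ {poly R}) -(@scalerAr _ {poly R}) !pintZ !mxE; ring.
have Gu : G \in unitmx.
  rewrite -row_free_unit; apply: inj_row_free => v vG0.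
  have : pint a b (P v * P v) = 0 by rewrite GE vG0 mul0mx mxE.
  move=> Pv0; apply/rowP => i.
  have /eqP/(congr1 (fun p : {poly R} => p`_i)) : P v == 0.
    rewrite -[_ == _]orbb -mulf_eq0; apply/eqP/(pint_ge0_eq0 ab) => // x _.
    by rewrite hornerM -expr2 sqr_ge0.
  by rewrite coef_poly ltn_ord valK coef0 mxE.
pose l : 'rV[R]_d := \row_i L 'X^i.
exists (P (invmx G *m l^T)^T) => p sp.
have -> : p = P (\row_(i < d) p`_i).
  apply/polyP => i; rewrite coef_poly; case: ltnP => [id|di].
    by rewrite insubT /= mxE.
  by rewrite nth_default // (leq_trans sp).
rewrite GE trmxK -mulmxA mulKVmx // PE linear_sum mxE; apply: eq_bigr => i _ /=.
by rewrite linearZ !mxE.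
Qed.

(** Cauchy-Schwarz against [q] cut off outside [[a, b]], whose L^2 norm is [M]; it makes functionals
    represented by [q] continuous. *)
Lemma pint_L2_bound a b q : a < b -> exists M : R, 0 <= M /\ forall h p, L2 h ->
  {in `[a, b], h =1 horner p} ->
  (`|pint a b (p * q)|%:E <= 'N[lebesgue_measure]_2%:E [EFin \o h] * M%:E)%E.
Proof.
move=> ab; pose q1 x := q.[x] * \1_`[a, b] x.
have mq1 : measurable_fun setT q1.
  apply: measurable_funM; last exact: measurable_indic.
  apply: continuous_measurable_fun; exact: continuous_horner.
have q1L2 : L2 q1.
  apply: (@L2_itv _ q1 (horner q) a b) => // [|x xab|x xab].
  - exact: continuous_horner.
  - by rewrite /q1 indicE mem_set // mulr1.
  - by rewrite /q1 indicE memNset ?mulr0 //; apply/negP.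
exists (fine ('N[lebesgue_measure]_2%:E [EFin \o q1])%E).
split=> [|h p hL2 hp]; first by rewrite fine_ge0 ?Lnorm_ge0.
rewrite fineK; last first.
  move: q1L2; rewrite /L2 /= inE => /andP[_]; rewrite inE /= => fq1.
  by rewrite ge0_fin_numE ?Lnorm_ge0.
have mh : measurable_fun setT h.
  by move: hL2; rewrite /L2 /= inE => /andP[]; rewrite inE.
apply: le_trans (@hoelder _ _ _ lebesgue_measure h q1 2 2 mh mq1 _ _ _) => //;
  last first.
  by rewrite [RHS]splitr !div1r.
have /Lfun1_integrable iF := Lfun2_mul_Lfun1 hL2 q1L2.
have -> : pint a b (p * q) = (\int[lebesgue_measure]_x (h x * q1 x))%R.
  rewrite -Rintegral_horner // Rintegral_mkcond.
  apply: eq_Rintegral => x _; rewrite patchE /q1 indicE.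
  case: ifPn => [|_]; last by rewrite !mulr0.
  by rewrite inE /= => xab; rewrite mulr1 hornerM hp.
rewrite EFin_normr_Rintegral // Lnorm1.
have [mF _] := integrableP _ _ _ iF.
exact: le_abse_integral.
Qed.

(** Chinese remaindering: with [u * P + v * Q = 1], the polynomial [a * v * Q] is [a] modulo [P] and
    0 modulo [Q]. *)
Lemma hermite (P Q a : {poly R}) : coprimep P Q -> P * Q != 0 ->
  exists q, [/\ (size q < size (P * Q)%R)%N, P %| q - a & Q %| q].
Proof.
move=> /Bezout_eq1_coprimepP[[u v] /= uv] PQ0.
exists ((a * v * Q) %% (P * Q)); split; first exact: ltn_modpN0.
- have := divp_eq (a * v * Q) (P * Q).
  set D := _ %/ _; set r := _ %% _ => E.
  have -> : r = a * v * Q - D * (P * Q) by rewrite E addrAC subrr add0r.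
  have -> : a * v * Q - D * (P * Q) - a = P * (- (D * Q) - a * u).
    by rewrite -{2}[a]mulr1 -uv; ring.
  exact: dvdp_mulIl.
- by rewrite -(dvdp_mod _ (dvdp_mulIr P Q)) dvdp_mull.
Qed.

Definition jet_form k (lam : 'I_k.+1 -> R) (c : R) (p : {poly R}) : R :=
  \sum_(i < k.+1) lam i * p^`(i).[c].

Fact jet_form_linear k (lam : 'I_k.+1 -> R) c : linear_for *%R (jet_form lam c).
Proof.
move=> t p q; rewrite /jet_form mulr_sumr -big_split /=; apply: eq_bigr => i _.
by rewrite derivnD derivnZ hornerD hornerZ; ring.
Qed.

HB.instance Definition _ k (lam : 'I_k.+1 -> R) c :=
  GRing.isLinear.Build R {poly R} R *%R (jet_form lam c) (jet_form_linear lam c).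

(** The piece of [f] between the knots [-j] and [1 - j], moved to [[0, 1]] with its jets at both
    ends. *)
Lemma V0_translate n k f j : V0 n k f -> exists p,
  [/\ (size p <= n.+1)%N, {in `[0, 1], translate j f =1 horner p},
     (forall i, (i <= k)%N -> p^`(i).[0] = derive1n i f (- j%:~R)) &
     (forall i, (i <= k)%N -> p^`(i).[1] = derive1n i f (1 - j%:~R))].
Proof.
move=> [_ Cf pf]; have [p [sp]] := pf (- j); rewrite rmorphN /= => fp.
have ab : - j%:~R < - j%:~R + 1 :> R by rewrite ltrDl.
exists (p \Po ('X + (- j%:~R)%:P)); split=> [|x|i ik|i ik].
- by rewrite size_comp_poly2 // size_XaddC.
- rewrite in_itv /= => /andP[x0 x1].
  rewrite horner_comp !hornerE /translate fp // in_itv /=; apply/andP; split; lra.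
- rewrite derivn_comp_addX horner_comp !hornerE.
  by rewrite (Ck_horner ab Cf fp ik) // in_itv /= lexx ltW.
- rewrite derivn_comp_addX horner_comp !hornerE addrC.
  by rewrite (Ck_horner ab Cf fp ik) // in_itv /= lexx ltW.
Qed.

(** Derivatives are read on an interval where [f] vanishes, lying on the outer side of [x]; this
    includes the boundary points 1 and -1. *)
Lemma derive1n_outside k f x i : Ck k f ->
  (forall y, y \notin `[-1, 1] -> f y = 0) -> 1 <= `|x| -> (i <= k)%N ->
  derive1n i f x = 0.
Proof.
move=> Cf f0 x1 ik.
have cf := Ck_continuous Cf.
have out a b : a < b -> (forall x, x \in `]a, b[ -> x \notin `[-1, 1]) ->
    {in `[a, b], derive1n i f =1 cst 0}.
  move=> ab about y yab.
  rewrite (Ck_horner (p := 0) ab Cf _ ik) ?linear0 ?horner0 //.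
  apply: continuous_eq_itv => //; first exact: continuous_horner.
  by move=> z /about /f0 ->; rewrite horner0.
move: x1; rewrite ler_normr => /orP[x1|x1].
  rewrite (out x (x + 1)) ?ltrDl ?in_itv /= ?lexx ?lerDl ?ler01 // => y.
  by rewrite !in_itv /=; lra.
rewrite (out (x - 1) x) ?ltrBlDr ?ltrDl ?in_itv /= ?lexx ?andbT //.
  by move=> y; rewrite !in_itv /=; lra.
by rewrite lerBlDr lerDl.
Qed.

End Jets.

(** * Jets at 0 realized by a generator *)

Section GeneratorJets.
Context {R : realType}.
Variables (n k : nat).
Hypothesis hn : (2 * k + 2 <= n)%N.
Implicit Types (p q s : {poly R}) (a b c x : R) (f g h : R -> R).
Implicit Types (Phi : set (R -> R)).

Lemma jets_poly (lam : nat -> R) m :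
  exists p, forall i, (i < m)%N -> p^`(i).[0] = lam i.
Proof.
exists (\poly_(i < m) (lam i / i`!%:R)) => i im.
rewrite horner_coef0 coef_derivn addn0 ffactnn coef_poly im -[LHS]mulr_natr.
by rewrite divfK.
Qed.

Lemma derivn_dvdp_eq m c p q : ('X - c%:P) ^+ m %| p - q ->
  forall i, (i < m)%N -> p^`(i).[c] = q^`(i).[c].
Proof.
move=> pq i im; apply/eqP; rewrite -subr_eq0 -hornerN -hornerD -derivnB.
by rewrite (dvdp_derivn_eq0 pq).
Qed.

(** Two-point Hermite interpolation on each side of 0, with the given jet at 0 and the zero jet at 1
    or -1. The pieces have degree at most [2k + 1], hence at most [n]. *)
Lemma V0_jets (lam : nat -> R) : exists f p,
  [/\ V0 n k f, (size p <= n.+1)%N, {in `[0, 1], f =1 horner p} &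
      forall i, (i <= k)%N -> p^`(i).[0] = lam i].
Proof.
have [a aE] := jets_poly lam k.+1.
have herm c : c != 0 -> exists q, [/\ (size q <= n.+1)%N,
    ('X - 0%:P) ^+ k.+1 %| q - a & ('X - c%:P) ^+ k.+1 %| q].
  move=> c0; have [||q [sq qa qc]] := @hermite R (('X - 0%:P) ^+ k.+1)
      (('X - c%:P) ^+ k.+1) a.
  - by rewrite coprimep_expl // coprimep_expr // coprimep_XsubC root_XsubC.
  - by rewrite mulf_neq0 // expf_neq0 // polyXsubC_eq0.
  exists q; split=> //; apply: leq_trans (ltnW _) _; first exact: sq.
  by rewrite size_monicM ?monic_exp ?monicXsubC ?expf_neq0 ?polyXsubC_eq0 //
    !size_exp_XsubC; lia.
have [qr [sr qra qr1]] := herm 1 (oner_neq0 _).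
have [|ql [sl qla ql1]] := herm (-1); first by rewrite oppr_eq0 oner_neq0.
(* This is [ql] between -1 and 0, [qr] between 0 and 1, and 0 elsewhere. *)
pose f := (trunc (-1) ql \- trunc 0 (ql - qr)) \- trunc 1 qr.
have q0 : ('X - 0%:P) ^+ k.+1 %| ql - qr.
  have -> : ql - qr = (ql - a) - (qr - a) by ring.
  exact: dvdp_sub.
have rt c p : ('X - c%:P) ^+ k.+1 %| p -> root p c.
  by move=> pc; rewrite -dvdp_XsubCl (dvdp_trans _ pc) // dvdp_exp.
have slr : (size (ql - qr)%R <= n.+1)%N.
  by rewrite (leq_trans (size_polyD _ _)) // geq_max size_polyN sl.
have /rootP := rt _ _ q0; rewrite hornerD hornerN => r0.
have /rootP rl := rt _ _ ql1; have /rootP rr := rt _ _ qr1.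
exists f, qr; split=> //.
- apply: (@V0_intro _ n k f (-1) 1).
  + by apply: CkB; [apply: CkB|]; exact: Ck_trunc.
  + have := @pieces_trunc _ n 1 _ sr; rewrite mulr1z => /(_ (rt _ _ qr1)).
    have := @pieces_trunc _ n 0 _ slr; rewrite mulr0z => /(_ (rt _ _ q0)).
    have := @pieces_trunc _ n (-1) _ sl; rewrite mulrN1z => /(_ (rt _ _ ql1)).
    by move=> *; apply: piecesB => //; exact: piecesB.
  + move=> x; rewrite in_itv /= negb_and -!ltNge /f /trunc /= => /orP[x1|x1].
      have [-> -> ->] : [/\ (-1 <= x) = false, (0 <= x) = false & (1 <= x) = false].
        by split; apply/negbTE; rewrite -ltNge; lra.
      by rewrite !subr0.
    have [-> -> ->] : [/\ -1 <= x, 0 <= x & 1 <= x] by split; lra.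
    by rewrite hornerD hornerN; ring.
- move=> x; rewrite in_itv /f /trunc /= => /andP[x0 x1].
  rewrite (ifT _ _ x0) ifT; last by lra.
  rewrite hornerD hornerN; case: leP => [x1'|_]; last by lra.
  have -> : x = 1 by lra.
  by rewrite rr; lra.
- by move=> i ik; rewrite (derivn_dvdp_eq qra) // aE.
Qed.

(* Otherwise some functional [phi |-> \sum_i lam i * phi^(i)(0)] kills all the
   translates of [Phi]. On the polynomials of degree at most [n] it is an inner
   product with a polynomial over [0, 1], hence it is continuous on [V0 n k] for
   the L^2 norm and would vanish on the closed span, i.e. on [V0 n k]. *)
Lemma generator_jets Phi (lam : 'I_k.+1 -> R) : is_generator n k Phi ->
  (forall phi, Phi phi -> \sum_(i < k.+1) lam i * derive1n i phi 0 = 0) ->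
  forall i, lam i = 0.
Proof.
move=> [_ PhiV0 Phisupp Phispan _] lam0.
(* The test function has jet [lam] itself, so the functional takes the value [\sum_i lam i ^+ 2] on
   it. *)
have [f [p [fV0 sp fp pj]]] := V0_jets (fun i => lam (inord i)).
have [q qE] := pint_riesz n.+1 (jet_form lam 0) (@ltr01 R).
have [M [M0 qM]] := pint_L2_bound q (@ltr01 R).
have Lp : jet_form lam 0 p = \sum_(i < k.+1) lam i ^+ 2.
  rewrite /jet_form; apply: eq_bigr => i _.
  by rewrite (pj i (ltn_ord i)) inord_val expr2.
have [S0|Spos] := leP (\sum_(i < k.+1) lam i ^+ 2) 0.
  move=> i; apply/eqP; rewrite -sqrf_eq0; apply/eqP.
  have sq0 j : true -> 0 <= lam j ^+ 2 by rewrite sqr_ge0.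
  apply: (psumr_eq0P sq0) => //; apply/eqP; rewrite eq_le S0.
  by apply: sumr_ge0 => j _; exact: sq0.
have : ae_class (V0 n k) f.
  by split; [case: fV0|exists f => //; exact: ae_eq_refl].
(* With [M] the continuity constant, this tolerance bounds the functional at [f] by [M / (M + 1)]
   times its own value, a contradiction; [M + 1] also allows [M = 0]. *)
rewrite -Phispan => -[_ /(_ ((\sum_(i < k.+1) lam i ^+ 2) / (M + 1)))].
case; first by rewrite divr_gt0 // ltr_wpDl.
move=> _ [m [g [c [gtr ->]]]]; set h := (fun x => (f x - _)%:E) => hsmall.
have gp i : exists pi : {poly R}, [/\ (size pi <= n.+1)%N,
    {in `[0, 1], g i =1 horner pi}, continuous (g i) & jet_form lam 0 pi = 0].
  have [phi Phiphi [j _ <-]] := gtr i.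
  have phiV0 := PhiV0 _ Phiphi; have [_ Cphi _] := phiV0.
  have [pi [spi phipi pij _]] := V0_translate j phiV0.
  exists pi; split=> //.
    move=> x; apply: continuous_comp; last exact: (Ck_continuous Cphi).
    by apply: cvgB; [exact: cvg_id|exact: cvg_cst].
  rewrite /jet_form; under eq_bigr => l _ do rewrite (pij l (ltn_ord l)).
  (* The untranslated functions are killed by hypothesis; for [j != 0] the jet is taken at an
     integer where all derivatives vanish. *)
  have [->|j0] := eqVneq j 0; first by rewrite oppr0 lam0.
  rewrite big1 // => l _.
  rewrite (derive1n_outside Cphi) ?mulr0 //; last exact: (ltn_ord l).
    exact/tsupp_subset_itv/Phisupp.
  by rewrite normrN norm_intr_ge1 ?intr_int ?intr_eq0.
have [P PE] := fin_all_exists gp.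
pose hr x := f x - \sum_(i < m) c i * g i x.
have cf : continuous f by case: fV0 => _ /Ck_continuous.
have chr : continuous hr.
  move=> x; apply: cvgB; first exact: cf.
  apply: cvg_big => [|i _]; first exact: add_continuous.
  by apply: cvgM; [exact: cvg_cst|have [_ _ /(_ x)] := PE i].
have hrL2 : L2 hr.
  rewrite /L2 /= inE; apply/andP; split.
    by rewrite inE /=; exact: continuous_measurable_fun.
  by rewrite inE /= /finite_norm (lt_trans hsmall) // ltry.
have hrp : {in `[0, 1], hr =1 horner (p - \sum_(i < m) c i *: P i)}.
  move=> x x01; rewrite /hr fp // hornerD hornerN horner_sum; congr (_ - _).
  by apply: eq_bigr => i _; rewrite hornerZ; have [_ ->] := PE i.
have := qM hr _ hrL2 hrp.
rewrite qE; last first.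
  rewrite (leq_trans (size_polyD _ _)) // geq_max sp size_polyN.
  rewrite (leq_trans (size_sum _ _ _)) //; apply/bigmax_leqP => i _.
  by rewrite (leq_trans (size_scale_leq _ _)) //; have [] := PE i.
have LS : jet_form lam 0 (\sum_(i < m) c i *: P i) = 0.
  rewrite linear_sum; apply: big1 => i _.
  by rewrite linearZ /=; have [_ _ _ ->] := PE i; rewrite mulr0.
rewrite linearB /= LS subr0.
rewrite Lp gtr0_norm // => le1.
have : ((\sum_(i < k.+1) lam i ^+ 2)%:E <=
        ((\sum_(i < k.+1) lam i ^+ 2) / (M + 1) * M)%:E)%E.
  apply: (le_trans le1); rewrite EFinM lee_wpmul2r ?lee_fin //.
  exact: ltW hsmall.
rewrite lee_fin -mulrA ler_pMr // ler_pdivlMl; last by rewrite ltr_wpDl.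
by rewrite mulr1 leNgt ltrDl ltr01.
Qed.

End GeneratorJets.

(** * The orthogonal complement *)

Section PolyOn.
Context {R : realType}.
Implicit Types (p q s : {poly R}) (a b c x : R) (f g h : R -> R).

(** A dictionary between functions and polynomials: [p] determines [f], and [f] determines [p] when
    [a < b]. *)
Definition poly_on a b p f :=
  (forall x, x \notin `[a, b] -> f x = 0) /\ {in `[a, b], f =1 horner p}.

Lemma poly_on_fun a b p f g : poly_on a b p f -> poly_on a b p g -> f = g.
Proof.
move=> [f0 fp] [g0 gp]; apply/funext => x.
by have [xab|xab] := boolP (x \in `[a, b]); [rewrite fp ?gp|rewrite f0 ?g0].
Qed.

Lemma poly_on_inj a b p q f : a < b ->
  poly_on a b p f -> poly_on a b q f -> p = q.
Proof.
by move=> ab [_ fp] [_ fq]; apply: (eq_horner_itv ab) => x xab; rewrite -fp ?fq.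
Qed.

Lemma poly_on_sum a b m (c : 'I_m -> R) (P : 'I_m -> {poly R})
    (g : 'I_m -> R -> R) : (forall i, poly_on a b (P i) (g i)) ->
  poly_on a b (\sum_(i < m) c i *: P i) (fun x => \sum_(i < m) c i * g i x).
Proof.
move=> gP; split=> x xab.
  by rewrite big1 // => i _; rewrite (gP i).1 ?mulr0.
rewrite horner_sum; apply: eq_bigr => i _; by rewrite hornerZ (gP i).2.
Qed.

Lemma poly_onB a b p q f g : poly_on a b p f -> poly_on a b q g ->
  poly_on a b (p - q) (f \- g).
Proof.
move=> [f0 fp] [g0 gq]; split=> x xab /=; first by rewrite f0 ?g0 ?subrr.
by rewrite fp ?gq // hornerD hornerN.
Qed.

Lemma poly_onD a b p q f g : poly_on a b p f -> poly_on a b q g ->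
  poly_on a b (p + q) (f \+ g).
Proof.
move=> [f0 fp] [g0 gq]; split=> x xab /=; first by rewrite f0 ?g0 ?addr0.
by rewrite fp ?gq // hornerD.
Qed.

Lemma poly_on_inner a b p q f g : a < b -> poly_on a b p f ->
  poly_on a b q g -> inner `[a, b] f g = pint a b (p * q).
Proof. by move=> ab [_ fp] [_ gq]; exact: inner_horner. Qed.

Lemma poly_on_indic a b p : poly_on a b p (fun x => p.[x] * \1_`[a, b] x).
Proof.
split=> x xab; last by rewrite indicE mem_set // mulr1.
by rewrite indicE memNset ?mulr0 //; apply/negP.
Qed.

(** [to01] and [to11] are the inverse affine bijections between [[-1, 1]] and [[0, 1]]. *)
Definition to01 : {poly R} := 2^-1 *: 'X + 2^-1%:P.
Definition to11 : {poly R} := 2 *: 'X - 1.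

Lemma half_dbl : to01 \Po to11 = 'X.
Proof.
rewrite /to01 /to11 comp_polyD comp_polyZ comp_polyX comp_polyC scalerBr scalerA.
by rewrite mulVf ?scale1r ?pnatr_eq0 // alg_polyC subrK.
Qed.

Lemma dbl_half : to11 \Po to01 = 'X.
Proof.
rewrite /to01 /to11 comp_polyB comp_polyZ comp_polyX comp_polyC scalerDr scalerA.
by rewrite mulfV ?scale1r ?pnatr_eq0 // -mul_polyC -polyCM mulfV ?pnatr_eq0 // addrK.
Qed.

Lemma size_half : size to01 = 2.
Proof.
rewrite /to01 size_polyDl ?size_scale ?size_polyX ?invr_eq0 ?pnatr_eq0 //.
by rewrite (leq_ltn_trans (size_polyC_leq1 _)).
Qed.

Lemma size_dbl : size to11 = 2.
Proof.
by rewrite /to11 size_polyDl ?size_polyN ?size_poly1 size_scale ?size_polyX ?pnatr_eq0.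
Qed.

Lemma poly_on_half p f : poly_on 0 1 p f ->
  poly_on (-1) 1 (p \Po to01) (fun t => f ((t + 1) / 2)).
Proof.
move=> [f0 fp]; split=> t tab.
  by apply: f0; move: tab; rewrite !in_itv /=; lra.
rewrite fp; last by move: tab; rewrite !in_itv /=; lra.
by rewrite horner_comp /to01 !hornerE; congr (_.[_]); field.
Qed.

Lemma poly_on_dbl p f : poly_on (-1) 1 p f ->
  poly_on 0 1 (p \Po to11) (fun x => f (2 * x - 1)).
Proof.
move=> [f0 fp]; split=> t tab.
  by apply: f0; move: tab; rewrite !in_itv /=; lra.
rewrite fp; last by move: tab; rewrite !in_itv /=; lra.
by rewrite horner_comp /to11 !hornerE.
Qed.

Lemma poly_on_unhalf p f : poly_on (-1) 1 p (fun t => f ((t + 1) / 2)) ->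
  poly_on 0 1 (p \Po to11) f.
Proof.
move=> /poly_on_dbl; congr (poly_on _ _ _ _).
by apply/funext => x; congr f; field.
Qed.

Lemma poly_on_undbl p f : poly_on 0 1 p (fun x => f (2 * x - 1)) ->
  poly_on (-1) 1 (p \Po to01) f.
Proof.
move=> /poly_on_half; congr (poly_on _ _ _ _).
by apply/funext => x; congr f; field.
Qed.

Lemma dvdp_half m c p : ('X - c%:P) ^+ m %| p ->
  ('X - (2 * c - 1)%:P) ^+ m %| p \Po to01.
Proof.
move=> /(dvdp_comp_poly to01); rewrite rmorphXn /= comp_polyB comp_polyX comp_polyC.
have -> : to01 - c%:P = 2^-1 *: ('X - (2 * c - 1)%:P).
  have -> : c%:P = (2^-1 * (2 * c - 1))%:P + 2^-1%:P :> {poly R}.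
    by rewrite -polyCD; congr _%:P; field.
  rewrite /to01 scalerBr -[_ *: _%:P]mul_polyC -polyCM; ring.
by rewrite exprZn dvdpZl // expf_neq0 // invr_eq0 pnatr_eq0.
Qed.

Lemma pint_dbl p : pint 0 1 (p \Po to11) = 2^-1 * pint (-1) 1 p.
Proof.
rewrite /to11 -polyC1 -polyCN pint_comp_affine ?pnatr_eq0 //.
by congr (_ * pint _ _ _); ring.
Qed.

Lemma rescaleP (X : set (R -> R)) f :
  rescale X f <-> X (fun x => f (2 * x - 1)).
Proof.
split=> [[g Xg <-]|Xf].
  suff -> : (fun x => g ((2 * x - 1 + 1) / 2)) = g by [].
  by apply/funext => x; congr g; field.
exists (fun x => f (2 * x - 1)) => //.
by apply/funext => x; congr f; field.
Qed.

End PolyOn.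

(** * The rescaled space [A0] in terms of polynomials *)

Section OrthogonalComplement.
Context {R : realType}.
Variables (n k : nat).
Hypothesis hn : (2 * k + 2 <= n)%N.
Implicit Types (p q s : {poly R}) (a b c x : R) (f g h : R -> R).
Implicit Types (Phi : set (R -> R)).

(** Its multiples of degree at most [n] are the rescaled elements of [A0]. *)
Definition bubble : {poly R} := (1 - 'X) ^+ k.+1 * (1 + 'X) ^+ k.+1.

Lemma bubble_dvdp q : (bubble %| q) =
  (('X - 1%:P) ^+ k.+1 %| q) && (('X - (-1)%:P) ^+ k.+1 %| q).
Proof.
rewrite /bubble -(eqp_dvdl _ (eqp_one_subX_exp _)).
have -> : 1 + 'X = 'X - (-1)%:P :> {poly R} by rewrite polyCN opprK addrC.
rewrite Gauss_dvdp // (eqp_coprimepl _ (eqp_one_subX_exp _)) coprimep_expl //.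
rewrite coprimep_expr // coprimep_XsubC root_XsubC.
by apply/eqP => ?; lra.
Qed.

Lemma A0P g : A0 n k g <-> exists q, [/\ (size q <= n.+1)%N, bubble %| q &
  poly_on (-1) 1 q (fun t => g ((t + 1) / 2))].
Proof.
(* Each of the two linear factors contributes a factor 1/2 under the substitution. *)
have bE : ((1 - 'X) ^+ k.+1 * 'X ^+ k.+1) \Po to01 =
          (4^-1) ^+ k.+1 *: bubble.
  rewrite comp_polyM !rmorphXn /= comp_polyB comp_polyC comp_polyX /bubble.
  have -> : 1%:P - to01 = 2^-1 *: (1 - 'X) :> {poly R}.
    have e : 1%:P = 2^-1%:P + 2^-1%:P :> {poly R} by rewrite -polyCD; congr _%:P; field.
    rewrite {1}e /to01 scalerBr alg_polyC; ring.
  have -> : to01 = 2^-1 *: (1 + 'X) :> {poly R}.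
    by rewrite /to01 scalerDr addrC alg_polyC.
  rewrite !exprZn -(@scalerAl _ {poly R}) -(@scalerAr _ {poly R}) scalerA.
  by rewrite -exprMn; congr (_ ^+ _ *: _); field.
split=> [/A0_horner[s [ss g0 gs]]|[q [sq bq gq]]].
  exists (((1 - 'X) ^+ k.+1 * 'X ^+ k.+1 * s) \Po to01); split.
  - by rewrite size_comp_poly2 ?size_half.
  - by rewrite comp_polyM bE -scalerAl -mul_polyC mulrCA dvdp_mulIl.
  - exact: poly_on_half.
have [g0 gp] := poly_on_unhalf gq.
have /dvdpP[s sE] : (1 - 'X) ^+ k.+1 * 'X ^+ k.+1 %| q \Po to11.
  have := dvdp_comp_poly to11 bq.
  have -> : bubble = 4 ^+ k.+1 *: (((1 - 'X) ^+ k.+1 * 'X ^+ k.+1) \Po to01).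
    by rewrite bE scalerA -exprMn mulfV ?pnatr_eq0 // expr1n scale1r.
  rewrite comp_polyZ -comp_polyA half_dbl comp_polyXr dvdpZl //.
apply: (@A0_intro _ n k s) => //; rewrite mulrC -sE //.
by rewrite size_comp_poly2 ?size_dbl.
Qed.

Lemma rpoly_bubble i q : (i <= k)%N -> (size q <= n.+1)%N -> bubble %| q ->
  pint (-1) 1 (rpoly n k i * q) = 0.
Proof.
move=> ik sq /dvdpP[s sE]; rewrite sE [s * _]mulrC rpoly_orth //.
have [->|s0] := eqVneq s 0; first by rewrite size_poly0.
move: sq; rewrite sE !size_mul ?mulf_neq0 // -?size_poly_eq0
  ?size_one_subX_exp ?size_one_addX_exp //.
by move: (size s) => m; lia.
Qed.

Lemma rtilde_poly_on i : poly_on (-1) 1 (rpoly n k i) (rtilde n k i : R -> R).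
Proof.
have -> : rtilde n k i = (fun x => (rpoly n k i).[x] * \1_`[(-1)%R, 1%R] x).
  apply/funext => t; rewrite /rtilde jacobi_natE /rpoly.
  by rewrite !(hornerM, horner_exp, hornerD, hornerN, hornerX, hornerC).
exact: poly_on_indic.
Qed.

Lemma ltilde_poly_on i :
  poly_on (-1) 1 (lpoly n k i) (ltilde n k i : R -> R).
Proof.
have [r0 rp] := rtilde_poly_on i; split=> t tab; rewrite /ltilde.
  by apply: r0; move: tab; rewrite !in_itv /=; lra.
rewrite rp; last by move: tab; rewrite !in_itv /=; lra.
by rewrite /lpoly horner_comp !hornerE.
Qed.

End OrthogonalComplement.

Lemma dvdp_sumZ {F : fieldType} m (c : 'I_m -> F) (P : 'I_m -> {poly F}) d :
  (forall i, d %| P i) -> d %| \sum_(i < m) c i *: P i.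
Proof.
move=> dP; apply: (big_ind (fun p => d %| p)) => [|p q|i _].
- exact: dvdp0.
- exact: dvdp_add.
- by rewrite -mul_polyC dvdp_mull.
Qed.

Lemma size_sumZ_leq {F : fieldType} m (c : 'I_m -> F) (P : 'I_m -> {poly F}) d :
  (forall i, (size (P i) <= d)%N) -> (size (\sum_(i < m) c i *: P i)%R <= d)%N.
Proof.
move=> Pd; apply: leq_trans (size_sum _ _ _) _; apply/bigmax_leqP => i _.
exact: leq_trans (size_scale_leq _ _) (Pd i).
Qed.

(** * The span of the [rtilde] and the space [C1] *)

Section Generators.
Context {R : realType}.
Variables (n k : nat) (Phi : set (R -> R)).
Hypotheses (hn : (2 * k + 2 <= n)%N) (genPhi : is_generator n k Phi).
Implicit Types (p q s : {poly R}) (f g h : R -> R).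

Let X1 : set (R -> R) := lspan [set restrict01 (translate 1 phi) | phi in Phi].

(** After the shift by 1, the end 0 comes from the support boundary -1, where all derivatives up to
    order [k] vanish, and the end 1 from the central knot 0. *)
Lemma restrict_translate_poly phi : Phi phi -> exists p,
  [/\ (size p <= n.+1)%N, ('X - 0%:P) ^+ k.+1 %| p,
      poly_on 0 1 p (restrict01 (translate 1 phi)) &
      forall i, (i <= k)%N -> p^`(i).[1] = derive1n i phi 0].
Proof.
move=> Phiphi; have phiV0 := generator_V0 genPhi Phiphi.
have /tsupp_subset_itv supp := generator_supp genPhi Phiphi.
have [_ Cphi _] := phiV0.
have [p [sp pphi p0 p1]] := V0_translate 1 phiV0.
exists p; split=> //.
- apply: derivn_eq0_dvdp => i ik; rewrite p0 // (derive1n_outside Cphi) //.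
  by rewrite normrN normr1.
- split=> x x01; rewrite /restrict01 /= indicE.
    by rewrite memNset ?mulr0 //; apply/negP.
  by rewrite mem_set // mulr1 pphi.
- by move=> i ik; rewrite p1 // subrr.
Qed.

Lemma X1_poly f : X1 f -> exists p,
  [/\ (size p <= n.+1)%N, ('X - 0%:P) ^+ k.+1 %| p & poly_on 0 1 p f].
Proof.
move=> [m [g [c [gPhi ->]]]].
have gp i : exists p, [/\ (size p <= n.+1)%N, ('X - 0%:P) ^+ k.+1 %| p &
    poly_on 0 1 p (g i)].
  have [phi Phiphi <-] := gPhi i.
  by have [p [? ? ? _]] := restrict_translate_poly Phiphi; exists p.
have [P PE] := fin_all_exists gp.
exists (\sum_(i < m) c i *: P i); split.
- by apply: size_sumZ_leq => i; have [] := PE i.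
- by apply: dvdp_sumZ => i; have [] := PE i.
- by apply: poly_on_sum => i; have [] := PE i.
Qed.

(** A relation between the columns of the jet matrix [J] would be a functional excluded by
    [generator_jets]; so [J] has full column rank and its rows span all jets. *)
Lemma X1_interp (v : 'I_k.+1 -> R) : exists f p,
  [/\ X1 f, poly_on 0 1 p f & forall i : 'I_k.+1, p^`(i).[1] = v i].
Proof.
have /finite_seqP[s sE] := generator_finite genPhi.
pose phi (i : 'I_(size s)) := nth (cst 0) s i.
have Phiphi i : Phi (phi i) by rewrite sE /= mem_nth.
pose J : 'M[R]_(size s, k.+1) := \matrix_(i, j) derive1n j (phi i) 0.
have Jfull : row_full J.
  rewrite /row_full -mxrank_tr -/(row_free J^T).
  apply: inj_row_free => w /rowP wJ; apply/rowP => j; rewrite mxE.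
  apply: (@generator_jets _ _ _ hn Phi (fun j => w 0 j) genPhi) => f.
  rewrite sE /= => /(nthP (cst 0))[l ls <-].
  have := wJ (Ordinal ls); rewrite !mxE => E; rewrite -[RHS]E.
  by apply: eq_bigr => i _; rewrite !mxE.
have /submxP[c cE] : (\row_j v j <= J)%MS by exact: submx_full.
have [P PE] := fin_all_exists (fun i => restrict_translate_poly (Phiphi i)).
exists (fun x => \sum_(i < size s) c 0 i * restrict01 (translate 1 (phi i)) x).
exists (\sum_(i < size s) c 0 i *: P i); split.
- exists (size s), (fun i => restrict01 (translate 1 (phi i))), (fun i => c 0 i).
  by split=> // i; exists (phi i).
- by apply: poly_on_sum => i; have [] := PE i.
- move=> j; have /rowP/(_ j) := cE; rewrite !mxE => ->.
  rewrite (linear_sum (derivn j)) horner_sum; apply: eq_bigr => i _.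
  have [_ _ _ Pj] := PE i.
  by rewrite /= derivnZ hornerZ mxE (Pj j (ltn_ord j)).
Qed.

Lemma rescale_C1E : lspan (range (fun i : 'I_k.+1 => rtilde n k i)) =
  rescale (C1 n k Phi).
Proof.
have lt11 : -1 < 1 :> R by lra.
apply/seteqP; split=> f.
- move=> [m [g [c [gr ->]]]].
  have {}gr i : exists j : 'I_k.+1, g i = rtilde n k j.
    by have [j _ <-] := gr i; exists j.
  have [l lE] := fin_all_exists gr.
  set Q := \sum_(i < m) c i *: rpoly n k (l i) : {poly R}.
  have fQ : poly_on (-1) 1 Q (fun x => \sum_(i < m) c i * g i x).
    by apply: poly_on_sum => i; rewrite lE; exact: rtilde_poly_on.
  move: (fun x => _) fQ => {}f fQ; apply/rescaleP.
  have := poly_on_dbl fQ; set F := (fun x => f _); set P := Q \Po to11 => FP.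
  have sQ : (size Q <= n.+1)%N.
    by apply: size_sumZ_leq => i; rewrite size_rpoly // -ltnS.
  have sP : (size P <= n.+1)%N by rewrite size_comp_poly2 ?size_dbl.
  have PQ : P \Po to01 = Q by rewrite -comp_polyA dbl_half comp_polyXr.
  have Q0 : ('X - (-1)%:P) ^+ k.+1 %| Q.
    apply: dvdp_sumZ => i; rewrite polyCN opprK addrC /rpoly dvdp_mulr //.
    exact: dvdp_mulIr.
  (* [u] gets the jet of [P] at 1. As [P] and [pu] both vanish to order [k.+1] at 0, the difference
     [F \- u] lies in [A0]. *)
  have [u [pu [X1u upu puj]]] := X1_interp (fun i => P^`(i).[1]).
  have [pu' [spu pu0 upu']] := X1_poly X1u.
  have E : pu' = pu := poly_on_inj ltr01 upu' upu.
  rewrite {}E {upu'} in spu pu0.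
  split; last first.
    move=> h /A0P[q [sq bq hq]].
    rewrite (poly_on_inner ltr01 FP (poly_on_unhalf hq)) -comp_polyM pint_dbl.
    rewrite /Q mulr_suml linear_sum big1 ?mulr0 // => i _.
    by rewrite -(@scalerAl _ {poly R}) /= pintZ rpoly_bubble ?mulr0 // -ltnS.
  exists u => //; exists (F \- u); last first.
    by apply/funext => x /=; rewrite addrC subrK.
  apply/A0P; exists ((P - pu) \Po to01); split.
  + rewrite size_comp_poly2 ?size_half //.
    by rewrite (leq_trans (size_polyD _ _)) // geq_max size_polyN sP.
  + rewrite bubble_dvdp; apply/andP; split.
      have -> : 1 = 2 * 1 - 1 :> R by ring.
      apply/dvdp_half/derivn_eq0_dvdp => i ik.
      by rewrite derivnB hornerD hornerN (puj (Ordinal ik)) subrr.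
    rewrite comp_polyB PQ dvdp_sub // -[X in 'X - X%:P]add0r -[0](mulr0 2).
    exact: dvdp_half.
  + apply: poly_on_half; exact: poly_onB.
- move=> /rescaleP[[u X1u [h A0h Fuh]] Forth].
  have [pu [spu pu0 upu]] := X1_poly X1u.
  have /A0P[q [sq bq hq]] := A0h.
  set F := (fun x => f _) in Fuh Forth.
  have FP : poly_on 0 1 (pu + (q \Po to11)) F.
    by rewrite Fuh; apply: poly_onD => //; exact: poly_on_unhalf.
  have fQ := poly_on_undbl FP; set Q := _ \Po to01 in fQ.
  have QE : Q = pu \Po to01 + q.
    by rewrite /Q comp_polyD -comp_polyA dbl_half comp_polyXr.
  have QP : Q \Po to11 = pu + (q \Po to11).
    by rewrite -comp_polyA half_dbl comp_polyXr.
  have sQ : (size Q <= n.+1)%N.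
    rewrite QE (leq_trans (size_polyD _ _)) // geq_max sq andbT.
    by rewrite size_comp_poly2 ?size_half.
  have Q0 : ('X - (-1)%:P) ^+ k.+1 %| Q.
    move: bq; rewrite bubble_dvdp QE => /andP[_ bq]; rewrite dvdp_add //.
    rewrite -[X in 'X - X%:P]add0r -[0](mulr0 2).
    exact: dvdp_half.
  (* The combination is chosen so that [D] vanishes to order [k.+1] at 1; at -1 both [Q] and the
     [rpoly] already do. *)
  have [c cD] := @rpoly_interp R n k k.+1 Q (leqnn _).
  set D := Q - _ in cD.
  have sD : (size D <= n.+1)%N.
    rewrite (leq_trans (size_polyD _ _)) // geq_max size_polyN sQ /=.
    by apply: (size_sumZ_leq (fun i : 'I_k.+1 => c i)) => i;
      rewrite size_rpoly // -ltnS.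
  have bD : bubble k %| D.
    rewrite bubble_dvdp -(eqp_dvdl _ (eqp_one_subX_exp _)) cD /=.
    rewrite dvdp_sub //; apply: (dvdp_sumZ (fun i : 'I_k.+1 => c i)) => i.
    rewrite polyCN opprK addrC /rpoly dvdp_mulr //; exact: dvdp_mulIr.
  (* [D] represents an element of [A0], so it is orthogonal to [Q] by hypothesis and to every
     [rpoly] by [rpoly_bubble], hence to itself. *)
  have D0 : D = 0.
    have := Forth (fun x => (D \Po to11).[x] * \1_`[0%R, 1%R] x).
    have hD := poly_on_indic 0 1 (D \Po to11).
    rewrite (poly_on_inner ltr01 FP hD) -QP -comp_polyM pint_dbl => QD0.
    have {}QD0 : pint (-1) 1 (Q * D) = 0.
      apply: (@mulfI _ (2^-1 : R)); first by rewrite invr_eq0 pnatr_eq0.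
      rewrite mulr0; apply/QD0/A0P; exists D; split=> //.
      by have := poly_on_half hD; rewrite -comp_polyA dbl_half comp_polyXr.
    have DD0 : pint (-1) 1 (D * D) = 0.
      rewrite {1}/D mulrBl pintB QD0 mulr_suml linear_sum big1 ?subr0 // => i _.
      by rewrite -(@scalerAl _ {poly R}) /= pintZ rpoly_bubble ?mulr0 // -ltnS.
    apply/eqP; rewrite -[_ == _]orbb -mulf_eq0.
    apply/eqP/(pint_ge0_eq0 lt11) => // x _.
    by rewrite hornerM -expr2 sqr_ge0.
  exists k.+1, (fun i : 'I_k.+1 => rtilde n k i), (fun i => c i); split.
    by move=> i; exists i.
  apply: (poly_on_fun fQ).
  have -> : Q = \sum_(i < k.+1) c i *: rpoly n k i by apply/eqP; rewrite -subr_eq0 -/D D0.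
  by apply: (poly_on_sum (fun i : 'I_k.+1 => c i)) => i; exact: rtilde_poly_on.
Qed.

End Generators.

(** * Pochhammer symbols at integers and the conclusion *)

Lemma poch_nat {R : realType} (m j : nat) :
  poch m.+1%:R j * m`!%:R = (m + j)`!%:R :> R.
Proof.
elim: j => [|j IHj]; first by rewrite /poch big_ord0 mul1r addn0.
rewrite /poch big_ord_recr /= mulrAC -/(poch _ _) IHj addnS factS natrM mulrC.
by rewrite -natrD addSn.
Qed.

Lemma poch_opp_nat {R : realType} (m j : nat) : (j <= m)%N ->
  poch (- m%:R) j = (-1) ^+ j * (m ^_ j)%:R :> R.
Proof.
elim: j => [|j IHj] jm; first by rewrite /poch big_ord0 ffactn0 mul1r.
rewrite /poch big_ord_recr /= -/(poch _ _) IHj ?(ltnW jm) //.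
by rewrite ffactnSr natrM natrB ?(ltnW jm) // exprSr; ring.
Qed.

Theorem theorem5 (R : realType) (k n : nat) (hn : (2 * k + 2 <= n)%N) :
  [/\ forall (i : 'I_k.+1) (g : R -> R), rescale (A0 n k) g ->
        inner `[(-1)%R, 1%R] (rtilde n k i) g = 0,
      forall i j : 'I_k.+1, i != j ->
        inner `[(-1)%R, 1%R] (rtilde n k i) (ltilde n k j) = 0 :> R,
      forall i : 'I_k.+1,
        inner `[(-1)%R, 1%R] (rtilde n k i) (ltilde n k i) != 0 :> R,
      forall Phi : set (R -> R), is_generator n k Phi ->
        is_basis (fun i : 'I_k.+1 => rtilde n k i) (rescale (C1 n k Phi)) &
      forall i : 'I_k.+1,
        inner `[(-1)%R, 1%R] (rtilde n k i) (ltilde n k i) =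
        2 ^+ (2 * n + 1) *
        ((n`!%:R ^+ 2 * poch (- n%:R + k%:R + i%:R + 1) (n - k - i - 1)) /
         (poch (n + k + i + 3)%:R (n - k - i - 1) * (2 * n + 1)`!%:R)) :> R].
Proof.
have lt11 : -1 < 1 :> R by lra.
have innerE (i j : 'I_k.+1) :
    inner `[(-1)%R, 1%R] (rtilde n k i) (ltilde n k j) =
    pint (-1) 1 (rpoly n k i * lpoly n k j) :> R.
  exact: (poly_on_inner lt11 (rtilde_poly_on _ _ _) (ltilde_poly_on _ _ _)).
have neq0 (i : 'I_k.+1) : pint (-1) 1 (rpoly n k i * lpoly n k i) != 0 :> R.
  exact: (rpoly_lpoly_diag_neq0 hn (ltn_ord i)).
have neqij (i j : 'I_k.+1) : i != j ->
    pint (-1) 1 (rpoly n k i * lpoly n k j) = 0 :> R.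
  by move=> ij; rewrite (rpoly_lpoly_neq hn (ltn_ord i) (ltn_ord j)).
split.
- move=> i g /rescaleP/A0P[q [sq bq gq]].
  have gE : (fun t => g (2 * ((t + 1) / 2) - 1)) = g.
    by apply/funext => t; congr g; field.
  rewrite gE in gq.
  rewrite (poly_on_inner lt11 (rtilde_poly_on _ _ _) gq).
  exact: (rpoly_bubble hn (ltn_ord i) sq bq).
- by move=> i j ij; rewrite innerE neqij.
- by move=> i; rewrite innerE.
- move=> Phi genPhi; split; last exact: rescale_C1E.
  move=> c c0 j.
  have /(poly_on_inj lt11) : poly_on (-1) 1 (\sum_(i < k.+1) c i *: rpoly n k i)
      (fun x => \sum_(i < k.+1) c i * rtilde n k i x).
    by apply: poly_on_sum => i; exact: rtilde_poly_on.
  move=> /(_ 0); rewrite (_ : (fun x => _) = fun=> 0); last exact/funext.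
  have p0 : poly_on (-1) 1 0 (fun _ : R => 0).
    by split=> // x _; rewrite horner0.
  move=> /(_ p0) E.
  (* Pairing with [lpoly n k j] isolates [c j], by biorthogonality. *)
  have : pint (-1) 1 ((\sum_(i < k.+1) c i *: rpoly n k i) * lpoly n k j) = 0.
    by rewrite E mul0r linear0.
  rewrite mulr_suml linear_sum (bigD1 j) //= big1 => [|i ij].
    rewrite -(@scalerAl _ {poly R}) pintZ addr0 => /eqP.
    by rewrite mulf_eq0 (negPf (neq0 j)) orbF => /eqP.
  by rewrite -(@scalerAl _ {poly R}) pintZ neqij ?mulr0.
- move=> i; rewrite innerE (rpoly_lpoly_diag hn (ltn_ord i)) /=.
  have ik : (i <= k)%N := ltn_ord i.
  set a := (i + k + 1)%N; set N := (n - k - i - 1)%N.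
  have aN : (n - a = N)%N by rewrite /a /N; lia.
  (* The Pochhammer symbol starts at [- N] and has [N] factors, so it equals [N]! up to the sign
     [(-1) ^+ N]. *)
  have -> : - n%:R + k%:R + i%:R + 1 = - N%:R :> R.
    have -> : n%:R = (N + (k + i + 1))%:R :> R.
      by congr _%:R; rewrite /N; lia.
    by rewrite !natrD; ring.
  rewrite poch_opp_nat // ffactnn aN.
  have -> : (n + k + i + 3 = (n + a).+1.+1)%N by rewrite /a; lia.
  (* This factorization cancels [(n + a).+1]! against one of the two factors [(2 * n + 1)]! in
     [rpoly_lpoly_diag]. *)
  have BE : (2 * n + 1)`!%:R = poch (n + a).+2%:R N * (n + a).+1`!%:R :> R.
    by rewrite poch_nat; congr (_`!%:R); rewrite /a /N; lia.
  have : (2 * n + 1)`!%:R != 0 :> R by rewrite pnatr_eq0 -lt0n fact_gt0.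
  rewrite BE mulf_eq0 negb_or => /andP[B0 G0].
  by field; rewrite B0 G0.
Qed.
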